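(* Let $F$ be a random self-affine function, and let $$\varphi:=\sum_{i=0}^{m-1}l_i\big(\mathbb{E}\log a_i-\log l_i\big).$$ (1) If $\varphi<0$, then almost surely, $F'(x)=0$ at $\lambda$-almost every $x\in[0,1]$. (2) If $\varphi\ge 0$, then almost surely, $F$ is non-differentiable at $\lambda$-almost every $x\in[0,1]$.
   Context: Let $m\ge 2$ and let $0=b_0<b_1<\dots<b_{m-1}<b_m=1$ be a fixed partition of $[0,1]$; put $l_i:=b_{i+1}-b_i$ for $i=0,\dots,m-1$. Let $\mathcal{I}_n:=\{0,1,\dots,m-1\}^n$ and $\mathcal{I}^*:=\bigcup_{n\ge 0}\mathcal{I}_n$ (the finite words, including the empty word $\varnothing$). For $\omega\in\mathcal{I}_n$ and $k\le n$, $\omega|_k=\omega_1\dots\omega_k$; $\omega i$ denotes concatenation. Let $(\Theta,\mathscr{F},\mathbb{P})$ be a probability space with expectation $\mathbb{E}$, and let $\{\mathbf{Y}_\omega=(y_{\omega 1},\dots,y_{\omega(m-1)}):\omega\in\mathcal{I}^*\}$ be independent random vectors on $\Theta$, with values in $[0,1]^{m-1}$, all having the same joint distribution; the coordinates of a single vector $\mathbf{Y}_\omega$ need not be independent. Write $\mathbf{Y}_\varnothing=(y_1,\dots,y_{m-1})$, and for every $\omega\in\mathcal{I}^*$ set $y_{\omega 0}:=0$, $y_{\omega m}:=1$ (so $y_0=0$, $y_m=1$). Assume $\mathbb{P}(y_i\in\{0,1\})=0$ for $i=1,\dots,m-1$, and $\mathbb{P}(y_{i+1}-y_i=b_{i+1}-b_i)<1$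 for $i=1,\dots,m-1$. For $\omega\in\mathcal{I}^*$ and $i\in\{0,\dots,m-1\}$ let $T_{\omega i}:[0,1]^2\to[0,1]^2$ be the random affine map $$T_{\omega i}(x,y)=\big((b_{i+1}-b_i)x+b_i,\ (y_{\omega(i+1)}-y_{\omega i})y+y_{\omega i}\big).$$ For $n\ge1$ and $\omega\in\mathcal{I}_n$ let $R_\omega:=T_{\omega|_1}\circ T_{\omega|_2}\circ\dots\circ T_{\omega|_n}([0,1]^2)$, and let $\Gamma:=\bigcap_{n\ge1}\bigcup_{\omega\in\mathcal{I}_n}R_\omega$. With probability one $\Gamma$ is the graph of a continuous function $F:[0,1]\to[0,1]$; this random function $F$ is called a random self-affine function. For $i\in\{0,\dots,m-1\}$ let $a_i:=|y_{i+1}-y_i|$. Since $0\le a_i\le1$, $\mathbb{E}\log a_i$ is well defined in $[-\infty,0]$ (with $\log 0=-\infty$), so $\varphi\in[-\infty,\infty)$. $\lambda$ is Lebesgue measure on $[0,1]$. ''Differentiable at $x$'' means having a finite derivative at $x$ (an infinite derivative counts as non-differentiable). *)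

(* Defs.v *)
From HB Require Import structures.
From mathcomp Require Import all_boot all_order all_algebra.
From mathcomp Require Import all_classical all_reals all_analysis.
Set Implicit Arguments.
Unset Strict Implicit.
Unset Printing Implicit Defensive.
Import Order.TTheory GRing.Theory Num.Theory.
Import numFieldNormedType.Exports.
Local Open Scope classical_set_scope.
Local Open Scope ring_scope.

Definition mutually_independent (R : realType) (d d' : measure_display)
    (Theta : measurableType d) (T : measurableType d') (P : probability Theta R)
    (I : choiceType) (X : I -> {RV P >-> T}) : Prop :=
  forall (s : seq I) (A : I -> set T), uniq s ->
    (forall i, measurable (A i)) ->
    P (\bigcap_(i in [set` s]) (X i @^-1` A i)) =
      (\prod_(i <- s) P (X i @^-1` A i))%E.

Definition identically_distributed (R : realType) (d d' : measure_display)
    (Theta : measurableType d) (T : measurableType d') (P : probability Theta R)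
    (I : Type) (X : I -> {RV P >-> T}) : Prop :=
  forall (i j : I) (A : set T), measurable A ->
    distribution P (X i) A = distribution P (X j) A.

(* The points b_0, b_1, ... are a sequence [b : nat -> R] of which only the
   values at 0, ..., m matter. *)
Definition is_partition (R : realType) (m : nat) (b : nat -> R) : Prop :=
  [/\ b 0%N = 0, b m = 1 & forall i, (i < m)%N -> b i < b i.+1].

Definition len (R : realType) (b : nat -> R) (i : nat) : R := b i.+1 - b i.

(* For v = (y_1, ..., y_(m-1)), [knot v k] is y_k for 0 <= k <= m, with the
   conventions y_0 = 0 and y_m = 1. *)
Definition knot (R : realType) (m : nat) (v : m.-1.-tuple R) (k : nat) : R :=
  (0 :: rcons v 1)`_k.

Definition affine_map (R : realType) (m : nat) (b : nat -> R)
    (v : m.-1.-tuple R) (i : nat) (p : R * R) : R * R :=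
  (len b i * p.1 + b i, (knot v i.+1 - knot v i) * p.2 + knot v i).

(* For w = w_1 ... w_n, [compose_maps b Y u w] is
   T_(u w_1) \o T_(u w_1 w_2) \o ... \o T_(u w_1 ... w_n), where T_(u i) is the
   affine map number i attached to the vector Y_u; here [Y] is one realization
   of the random vectors. *)
Fixpoint compose_maps (R : realType) (m : nat) (b : nat -> R)
    (Y : seq 'I_m -> m.-1.-tuple R) (u w : seq 'I_m) : R * R -> R * R :=
  if w is i :: w' then
    affine_map b (Y u) i \o compose_maps b Y (rcons u i) w'
  else id.

Definition rectangle (R : realType) (m : nat) (b : nat -> R)
    (Y : seq 'I_m -> m.-1.-tuple R) (w : seq 'I_m) : set (R * R) :=
  compose_maps b Y [::] w @` (`[0, 1] `*` `[0, 1]).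

Definition limit_set (R : realType) (m : nat) (b : nat -> R)
    (Y : seq 'I_m -> m.-1.-tuple R) : set (R * R) :=
  \bigcap_(n in [set n | (1 <= n)%N])
    \bigcup_(w in [set w | size w = n]) rectangle b Y w.

(* Functions on [0, 1] are represented by total functions whose values outside
   [0, 1] are irrelevant. *)
Definition random_self_affine (R : realType) (d : measure_display)
    (Theta : measurableType d) (P : probability Theta R) (m : nat)
    (b : nat -> R) (Y : seq 'I_m -> {RV P >-> m.-1.-tuple R})
    (F : Theta -> R -> R) : Prop :=
  {ae P, forall t, {within `[0, 1], continuous (F t)} /\
    limit_set b (fun w => Y w t) =
      [set p | p.1 \in `[0, 1]%R /\ p.2 = F t p.1]}.

Definition height (R : realType) (m : nat) (v : m.-1.-tuple R) (i : nat) : R :=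
  `|knot v i.+1 - knot v i|.

(* The expectation is an extended-real integral, as [lne 0 = -oo]; the
   library's ['E_P[_]] only applies to real-valued random variables. *)
Definition phi (R : realType) (d : measure_display)
    (Theta : measurableType d) (P : probability Theta R) (m : nat)
    (b : nat -> R) (Y : seq 'I_m -> {RV P >-> m.-1.-tuple R}) : \bar R :=
  (\sum_(i < m) (len b i)%:E *
     ((\int[P]_t lne (height (Y [::] t) i)%:E) - (ln (len b i))%:E))%E.

(* Main.v *)
Require Import Defs.
From HB Require Import structures.
From mathcomp Require Import all_boot all_order all_algebra.
From mathcomp Require Import all_classical all_reals all_analysis.
From mathcomp Require Import measurable_realfun lra ring zify.
Set Implicit Arguments.
Unset Strict Implicit.
Unset Printing Implicit Defensive.
Import Order.TTheory GRing.Theory Num.Theory.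
Import numFieldNormedType.Exports.
Local Open Scope classical_set_scope.
Local Open Scope ring_scope.

(** Choose the realization t with law P and, independently, a point x uniformly
in [0, 1[.  Let w_0 w_1 w_2 ... be the address of x in the nested partitions
generated by b.  Over the n-th interval of this address, of length l, the graph
of F runs from one corner of its rectangle to the opposite one, so the chord
slope there is the signed height of the rectangle divided by l, which is the
product s_0 * ... * s_(n-1) with s_k the increment of Y_(w_0 ... w_(k-1)) at the
digit w_k, divided by the length attached to w_k ([rise_word], [curve_chord]).
Under the joint law of (t, x) the variables s_k are independent and identically
distributed ([slope_iid]), they are bounded, and the expectation of log |s_0| is
phi ([integral_lne_slope]).  The theorem thus compares the growth of a product of
i.i.d. factors with differentiability.

If phi < 0, then E |s_0|^a < 1 for some a > 0, because the right derivative of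
a |-> E |s_0|^a at 0 is phi ([exists_powR_moment_lt1]); Markov's inequality and
the Borel-Cantelli lemma make the product smaller than r^n for some r < 1 and
all large n ([iid_prod_exponentially_small]).  The oscillation of F on the n-th
interval is at most the height of its rectangle.  A point x + h that leaves the
address of x between the levels n and n + 1 is at distance at least
q^(n+1) times the length of the (n+1)-st interval for any fixed q < 1 and all
large n, since the iterates of the shift of x are uniform
([iter_shift_away_from_endpoints]).  Taking r < q makes the difference quotient
tend to 0 ([decay_is_derive0]).

If phi >= 0, a finite derivative at x would be the limit of the chord slopes
around x ([derivable_prod_cvg]).  A nonzero limit forces s_n to tend to 1, which
has probability 0 because s_0 is not almost surely 1 ([iid_not_cvg1]).  A limit 0
means that the walk log |s_0| + ... + log |s_(n-1)|, whose steps are bounded above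
and have nonnegative mean, tends to -oo while staying below some level K.  Stopping
the walk when it exceeds K bounds it above, by K up to one step, without
decreasing its mean, and Fatou's lemma shows that the stopped walk does not tend to
-oo ([iid_prod_not_cvg0]). *)

(** * Recursions driven by an independent sequence *)

Section iid_recursion.
Context {d : measure_display} {T : measurableType d} {R : realType}
  (P : probability T R).

(** Independence and equality of the laws in one identity: with all but one of
the sets B k equal to the whole line it says that s k has the law of s 0. *)
Definition iid (s : nat -> T -> R) : Prop :=
  forall n (B : nat -> set R), (forall k, measurable (B k)) ->
    P (\bigcap_(k < n) (s k @^-1` B k)) =
      (\prod_(k < n) P (s 0%N @^-1` B k))%E.

(** Powers of partial products and stopped partial products both have this
form, so that one independence lemma serves both. *)
Fixpoint recursion (g : R * R -> R) (c : R) (s : nat -> T -> R) (n : nat)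
    : T -> R :=
  if n is k.+1 then fun t => g (recursion g c s k t, s k t) else cst c.

Variables (s : nat -> T -> R) (g : R * R -> R) (c : R).
Hypothesis ms : forall k, measurable_fun setT (s k).
Hypothesis mg : measurable_fun setT g.
Hypothesis siid : iid s.
Let p := recursion g c s.

Lemma measurable_recursion n : measurable_fun setT (p n).
Proof.
elim: n => [|n ih]; first exact: measurable_cst.
apply: (measurableT_comp mg); exact: measurable_fun_pair.
Qed.

Let mpre (f : T -> R) (A : set R) :
  measurable_fun setT f -> measurable A -> measurable (f @^-1` A).
Proof. by move=> mf mA; rewrite -[X in measurable X]setTI; exact: mf. Qed.

Let mtail n N (B : nat -> set R) : (forall k, measurable (B k)) ->
  measurable (\bigcap_(k < N) (s (n + k)%N @^-1` B k)).
Proof.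
by move=> mB; apply: fin_bigcap_measurable => //= k _; apply: mpre.
Qed.

(** The value of the recursion after n steps is determined by the first n
variables.  Joining s n to it needs more than products of events, since the next
value depends on the pair through g; the pair is handled by the uniqueness of
product measures, applied on the event W of the future. *)
Lemma recursion_indep_future n : forall N (A : set R) (B : nat -> set R),
  measurable A -> (forall k, measurable (B k)) ->
  P (p n @^-1` A `&` \bigcap_(k < N) (s (n + k)%N @^-1` B k)) =
  (P (p n @^-1` A) * \prod_(k < N) P (s 0%N @^-1` B k))%E.
Proof.
elim: n => [|n ih] N A B mA mB.
  rewrite /p /=; have [cA|cA] := boolP (c \in A).
    have -> : cst c @^-1` A = [set: T].
      by apply/seteqP; split => // t _; rewrite inE in cA.
    by rewrite setTI probability_setT mul1e -siid.
  have -> : cst c @^-1` A = set0 :> set T.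
    by apply/seteqP; split => // t /= At; move: cA; rewrite notin_setE.
  by rewrite set0I measure0 mul0e.
pose pm : {mfun T >-> R} := mfun_Sub (mem_set (measurable_recursion n)).
pose s0 : {mfun T >-> R} := mfun_Sub (mem_set (ms 0)).
pose W := \bigcap_(k < N) (s (n.+1 + k)%N @^-1` B k).
have mW : measurable W by exact: mtail.
pose q := (\prod_(k < N) P (s 0%N @^-1` B k))%E.
have q0 : (0 <= q)%E by apply: prode_ge0 => k _; exact: measure_ge0.
have qfin : q \is a fin_num.
  by rewrite /q; apply: prode_fin_num => k _; apply: fin_num_measure; exact: mpre.
have q0' : 0 <= fine q by exact: fine_ge0.
pose qn := NngNum q0'.
have mpair : measurable_fun setT (fun t => (p n t, s n t)).
  by apply: measurable_fun_pair => //; exact: measurable_recursion.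
pose X : {mfun T >-> (R * R)%type} := mfun_Sub (mem_set mpair).
pose mu1 := pushforward (mrestr P mW) X.
pose mu2 := mscale qn (distribution P X).
have rect1 A1 A2 : measurable A1 -> measurable A2 ->
    mu1 (A1 `*` A2) = (P (p n @^-1` A1) * P (s 0%N @^-1` A2) * q)%E.
  move=> m1 m2.
  pose B' k := if k is k'.+1 then B k' else A2.
  have mB' k : measurable (B' k) by case: k.
  have := ih N.+1 A1 B' m1 mB'; rewrite big_ord_recl/= -/q muleA => <-.
  rewrite /mu1 /pushforward /mrestr; congr (P _).
  apply/seteqP; split => [t /= [[A1t A2t] Wt]|t /= [A1t Wt]].
    split => // -[_|k kN] /=; first by rewrite addn0.
    by rewrite addnS -addSn; exact: Wt.
  split; first by split => //; have /= := Wt 0%N; rewrite addn0; exact.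
  by move=> k /= kN; rewrite addSn -addnS; exact: (Wt k.+1 kN).
have rect2 A1 A2 : measurable A1 -> measurable A2 ->
    mu2 (A1 `*` A2) = (P (p n @^-1` A1) * P (s 0%N @^-1` A2) * q)%E.
  move=> m1 m2; rewrite /mu2 /mscale /= fineK// muleC; congr (_ * _)%E.
  have := ih 1%N A1 (fun=> A2) m1 (fun=> m2).
  rewrite big_ord1/= => <-; congr (P _); rewrite bigcap_mkord big_ord1 addn0.
  by apply/seteqP; split => t /=.
have mu12 E : measurable E -> mu1 E = mu2 E.
  move=> mE.
  pose m1 := distribution P pm.
  pose m2 := mscale qn (distribution P s0).
  have m12E A1 A2 : (m1 A1 * m2 A2)%E =
      (P (p n @^-1` A1) * P (s 0%N @^-1` A2) * q)%E.
    by rewrite /m1 /m2 /mscale /distribution /pushforward /= fineK// -muleA;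
      congr (_ * _)%E; rewrite muleC.
  transitivity ((m1 \x m2)%E E).
    apply/esym/product_measure_unique => // A1 A2 mA1 mA2.
    by rewrite m12E; exact: rect1.
  by apply/product_measure_unique => // A1 A2 mA1 mA2; rewrite m12E; exact: rect2.
have := mu12 _ (measurable_funP (mfun_Sub (mem_set mg)) measurableT _ mA).
rewrite setTI /mu1 /mu2 /mscale/= fineK// [RHS]muleC.
by [].
Qed.

End iid_recursion.

Section iid_integrals.
Context {d : measure_display} {T : measurableType d} {R : realType}
  (P : probability T R).
Variables (s : nat -> T -> R) (g : R * R -> R) (c : R).
Hypothesis ms : forall k, measurable_fun setT (s k).
Hypothesis mg : measurable_fun setT g.
Hypothesis siid : iid P s.
Local Notation p := (recursion g c s).
Local Open Scope ereal_scope.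

(** The joint law of the two factors is the product of their laws, so this is
Tonelli's theorem. *)
Lemma integral_recursion_mul n (h k : R -> \bar R) :
  measurable_fun setT h -> measurable_fun setT k ->
  (forall x, 0 <= h x) -> (forall x, 0 <= k x) ->
  \int[P]_t (h (p n t) * k (s n t)) =
  (\int[P]_t h (p n t)) * \int[P]_t k (s 0%N t).
Proof.
move=> mh mk h0 k0.
have mp := measurable_recursion c ms mg.
pose pm : {mfun T >-> R} := mfun_Sub (mem_set (mp n)).
pose s0 : {mfun T >-> R} := mfun_Sub (mem_set (ms 0)).
have mX : measurable_fun setT (fun t => (p n t, s n t)).
  exact: measurable_fun_pair.
pose X : {mfun T >-> (R * R)%type} := mfun_Sub (mem_set mX).
pose m1 := distribution P pm.
pose m2 := distribution P s0.
have joint E : measurable E -> distribution P X E = (m1 \x m2) E.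
  move=> mE; apply/esym/product_measure_unique => // A1 A2 mA1 mA2.
  have := recursion_indep_future c ms mg siid n 1 mA1 (fun=> mA2).
  rewrite big_ord1/= => <-; congr (P _); rewrite bigcap_mkord big_ord1 addn0.
  by apply/seteqP; split => t /=.
pose f (z : R * R) := h z.1 * k z.2.
have mf : measurable_fun setT f.
  by apply: emeasurable_funM; exact: measurableT_comp.
have f0 z : 0 <= f z by exact: mule_ge0.
transitivity (\int[distribution P X]_z f z).
  by rewrite ge0_integral_pushforward.
rewrite (eq_measure_integral (m1 \x m2)); last by move=> A mA _; exact: joint.
rewrite fubini_tonelli1// /fubini_F /=.
under eq_integral do rewrite /f/= ge0_integralZl//.
rewrite ge0_integralZr//; last exact: integral_ge0.
by congr (_ * _); rewrite ge0_integral_pushforward.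
Qed.

End iid_integrals.

Section probability_facts.
Context {d : measure_display} {T : measurableType d} {R : realType}
  (P : probability T R).
Local Open Scope ereal_scope.

Lemma integral_cst_probability (r : \bar R) : \int[P]_t r = r.
Proof.
have -> : \int[P]_t r = r * P setT by exact: integral_cst.
by rewrite probability_setT mule1.
Qed.

(** The integral of f may be -oo here, as happens to the logarithm of a height
that vanishes with positive probability. *)
Lemma integral_cstB (M : R) (f : T -> \bar R) : (0 <= M)%R ->
  measurable_fun setT f -> (forall t, f t <= M%:E) ->
  \int[P]_t (M%:E - f t) = M%:E - \int[P]_t f t.
Proof.
move=> M0 mf fM.
have mp : measurable_fun setT f^\+ by exact: measurable_funepos.
have mn : measurable_fun setT f^\- by exact: measurable_funeneg.
have pM t : f^\+ t <= M%:E by rewrite funeposE ge_max fM lee_fin.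
have pfin t : f^\+ t \is a fin_num.
  by rewrite ge0_fin_numE ?funepos_ge0// (le_lt_trans (pM t)) ?ltry.
have mBp : measurable_fun setT (fun t => M%:E - f^\+ t).
  by apply: emeasurable_funB => //; exact: measurable_cst.
have Bp0 t : 0 <= M%:E - f^\+ t by rewrite sube_ge0 ?pfin ?orbT.
have fE t : M%:E - f t = (M%:E - f^\+ t) + f^\- t.
  by rewrite {1}(funeposneg f) oppeB ?fin_num_adde_defr ?pfin// addeA.
have IpM : \int[P]_t f^\+ t <= M%:E.
  rewrite -[leRHS]mule1 -(@probability_setT _ _ _ P) -integral_cst//.
  by apply: ge0_le_integral => //= t _; exact: funepos_ge0.
have Ip0 : 0 <= \int[P]_t f^\+ t by apply: integral_ge0 => t _; exact: funepos_ge0.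
have Ipfin : \int[P]_t f^\+ t \is a fin_num.
  by rewrite ge0_fin_numE// (le_lt_trans IpM) ?ltry.
under eq_integral do rewrite fE.
have IB : \int[P]_t (M%:E - f^\+ t) + \int[P]_t f^\+ t = M%:E.
  rewrite -ge0_integralD//.
  rewrite (eq_integral (cst M%:E)); last by move=> t _; rewrite subeK.
  exact: integral_cst_probability.
rewrite ge0_integralD// [in RHS]integralE.
move: IB Ipfin; move: (\int[P]_t (M%:E - f^\+ t)) (\int[P]_t f^\+ t)
  (\int[P]_t f^\- t) => a b e.
by move=> <- bfin; rewrite oppeB ?fin_num_adde_defr// addeA addeK.
Qed.

Lemma borel_cantelli_ae (mu : {measure set T -> \bar R}) (F : nat -> set T) :
  (forall k, measurable (F k)) -> \sum_(n <oo) mu (F n) < +oo ->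
  {ae mu, forall t, \forall n \near \oo, ~ F n t}.
Proof.
move=> mF sF; exists (lim_sup_set F); split.
- by apply: bigcapT_measurable => n; exact: bigcup_measurable.
- exact: lim_sup_set_cvg0.
- move=> t /= nt n _; apply: contrapT => nF; apply: nt.
  by exists n => // k /= nk Fk; apply: nF; exists k.
Qed.

Lemma measurable_lne (f : T -> R) :
  measurable_fun setT f -> measurable_fun setT (fun t => lne (f t)%:E).
Proof.
move=> mf; rewrite /lne; apply: measurable_fun_ifT => //=.
  exact: measurable_fun_ler.
by apply/measurable_EFinP; exact: measurableT_comp.
Qed.

End probability_facts.

(** * Negative drift: exponential decay of products *)

Section contraction.
Context {d : measure_display} {T : measurableType d} {R : realType}
  (P : probability T R).

Lemma expR_sub1_le (x : R) : expR x - 1 <= x * expR x.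
Proof.
have := expR_ge1Dx (- x); rewrite expRN => h.
have e0 := expR_gt0 x.
have : (1 - x) * expR x <= 1 by rewrite -ler_pdivlMr// div1r.
lra.
Qed.

Lemma powR_difference_quotient_cvg (y : R) : 0 < y ->
  k.+1%:R * (y `^ k.+1%:R^-1 - 1) @[k --> \oo] --> ln y.
Proof.
move=> y0; set u := ln y.
have yE k : y `^ k.+1%:R^-1 = expR (k.+1%:R^-1 * u).
  by rewrite /powR gt_eqF.
have k0 k : 0 < k.+1%:R :> R by rewrite ltr0n.
apply: (@squeeze_cvgr _ _ _ _ (fun=> u)
  (fun k => u * expR (k.+1%:R^-1 * u))).
- apply: nearW => k; rewrite yE; apply/andP; split.
    rewrite mulrC -ler_pdivrMr// lerBrDl mulrC; exact: expR_ge1Dx.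
  rewrite mulrC -ler_pdivlMr// (le_trans (expR_sub1_le _))//.
  by rewrite (mulrC _^-1) mulrAC.
- exact: cvg_cst.
- have uE : u * expR (0 * u) = u by rewrite mul0r expR0 mulr1.
  rewrite -[X in _ --> X]uE.
  apply: cvgM; first exact: cvg_cst.
  apply: continuous_cvg; first exact: continuous_expR.
  by apply: cvgM; [exact: (@cvg_harmonic R)|exact: cvg_cst].
Qed.

Local Open Scope ereal_scope.

(** The quotients (Y^a - 1) / a decrease to log Y as a decreases to 0, so their
integrals should have a negative limit.  As log Y need not be integrable, the
limit is taken by Fatou's lemma applied to M minus the quotients for a = 1/(k+1),
where M is a common upper bound. *)
Lemma exists_powR_moment_lt1 (C : R) (Y : T -> R) : (1 <= C)%R ->
  measurable_fun setT Y -> (forall t, (0 <= Y t <= C)%R) ->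
  \int[P]_t lne (Y t)%:E < 0 ->
  exists2 a : R, (0 < a)%R & \int[P]_t (Y t `^ a)%:E < 1.
Proof.
move=> C1 mY YC phi0; apply: contrapT => noa.
have {noa}ge1 k : 1 <= \int[P]_t (Y t `^ k.+1%:R^-1)%:E.
  rewrite leNgt; apply/negP => lt1; apply: noa.
  by exists k.+1%:R^-1%R; rewrite ?invr_gt0 ?ltr0n.
have C0 : (0 < C)%R by exact: lt_le_trans C1.
have lnC0 : (0 <= ln C)%R by exact: ln_ge0.
pose M := (C * ln C)%R.
have M0 : (0 <= M)%R by rewrite mulr_ge0// ltW.
pose q k t := (k.+1%:R * (Y t `^ k.+1%:R^-1 - 1))%R.
have qM k t : (q k t <= M)%R.
  have /andP[Y0 YC'] := YC t.
  have k0 : (0 < k.+1%:R :> R)%R by rewrite ltr0n.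
  rewrite /q mulrC -ler_pdivlMr//.
  apply: (@le_trans _ _ (C `^ k.+1%:R^-1 - 1)%R).
    by rewrite lerD2r ge0_ler_powR// ?nnegrE// ltW.
  rewrite /powR gt_eqF// (le_trans (expR_sub1_le _))//.
  set e := expR _; have eC : (e <= C)%R.
    by rewrite -[leRHS](lnK C0)// ler_expR ler_piMl// invf_le1// ler1n.
  rewrite mulrC mulrA /M mulrAC ler_pM2r ?invr_gt0// ler_wpM2r//.
have mq k : measurable_fun setT (q k).
  apply: measurable_funM; first exact: measurable_cst.
  apply: measurable_funB; last exact: measurable_cst.
  exact: (measurableT_comp (measurable_powR _)).
have mpow k : measurable_fun setT (fun t => Y t `^ k.+1%:R^-1)%R.
  exact: (measurableT_comp (measurable_powR _)).
have Iq k : \int[P]_t (M%:E - (q k t)%:E) <= M%:E.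
  have k0 : (0 < k.+1%:R :> R)%R by rewrite ltr0n.
  pose D := (M / k.+1%:R + 1)%R.
  have D0 : (0 <= D)%R by rewrite addr_ge0// divr_ge0// ltW.
  have powD t : (Y t `^ k.+1%:R^-1 <= D)%R.
    by rewrite -lerBlDr ler_pdivlMr// mulrC; exact: qM.
  rewrite (eq_integral (fun t => k.+1%:R%:E * (D%:E - (Y t `^ k.+1%:R^-1)%:E))).
    rewrite ge0_integralZl//; last 2 first.
    - apply: emeasurable_funB; first exact: measurable_cst.
      exact/measurable_EFinP.
    - by move=> t _; rewrite -EFinB lee_fin subr_ge0.
    rewrite integral_cstB//; last exact/measurable_EFinP.
    rewrite -lee_pdivlMl// (le_trans (leeB (lexx _) (ge1 k)))//.
    by rewrite -EFinB -EFinM lee_fin /D addrK mulrC.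
  move=> t _; rewrite -!EFinB -EFinM; congr EFin.
  rewrite /q /D; move: (Y t `^ _)%R (lt0r_neq0 k0) => y.
  by move: k.+1%:R => z z0; field.
have lnY t : lne (Y t)%:E <= M%:E.
  have /andP[Y0 YC'] := YC t.
  apply: (@le_trans _ _ (lne C%:E)).
    by rewrite lee_lne ?in_itv/= ?leey ?andbT ?lee_fin// ltW.
  by rewrite lne_EFin// lee_fin /M ler_peMl.
have lim t : M%:E - (q k t)%:E @[k --> \oo] --> M%:E - lne (Y t)%:E.
  have /andP[Y0 _] := YC t.
  have [Yt0|Yt0] := eqVneq (Y t) 0%R.
    rewrite Yt0 le0_lneNy//= addey//.
    have -> : (fun k => M%:E - (q k t)%:E) = (fun k => (M + k.+1%:R)%:E).
      apply/funext => k; rewrite -EFinB /q Yt0 powR0 ?invr_eq0//.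
      by rewrite sub0r mulrN1 opprK.
    apply/cvgeryP/cvgryPge => A; exists (Num.truncn A).+1 => //= k /= Ak.
    rewrite -[leLHS]add0r lerD// (le_trans (ltW (truncnS_gt A)))// ler_nat.
    exact: leqW.
  have Ygt : (0 < Y t)%R by rewrite lt_neqAle eq_sym Yt0.
  rewrite lne_EFin//.
  apply: (@cvg_comp _ _ _ (fun k => M - q k t)%R EFin _ (nbhs (M - ln (Y t))%R)).
    apply: cvgB; first exact: cvg_cst.
    exact: powR_difference_quotient_cvg.
  by apply: cvg_id.
have : \int[P]_t (M%:E - lne (Y t)%:E) <= M%:E.
  have le_ := @fatou _ _ _ P setT measurableT (fun k t => M%:E - (q k t)%:E).
  have {}le_ : \int[P]_t limn_einf (fun k => M%:E - (q k t)%:E) <=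
      limn_einf (fun k => \int[P]_t (M%:E - (q k t)%:E)).
    apply: le_ => [k|k t _]; last by rewrite sube_ge0// lee_fin.
    by apply: emeasurable_funB => //; exact/measurable_EFinP.
  rewrite (eq_integral (fun t => M%:E - lne (Y t)%:E)) in le_; last first.
    by move=> t _; exact: (cvg_limn_einf_sup (lim t)).1.
  apply: (le_trans le_); rewrite limn_einf_lim; apply: lime_le.
    exact: is_cvg_einfs.
  apply: nearW => n; apply: le_trans (Iq n).
  by apply: ereal_inf_lbound; exists n => /=.
rewrite integral_cstB//; last exact: measurable_lne.
move: phi0; case: (\int[P]_t lne (Y t)%:E) => [r| |]//.
by rewrite -EFinB lee_fin lte_fin; lra.
Qed.

End contraction.

Section exponential_decay.
Context {d : measure_display} {T : measurableType d} {R : realType}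
  (P : probability T R).

Lemma iid_comp (s : nat -> T -> R) (f : R -> R) : measurable_fun setT f ->
  iid P s -> iid P (fun k t => f (s k t)).
Proof.
move=> mf si n B mB; rewrite -(si n (fun k => f @^-1` B k))// => k.
by rewrite -[X in measurable X]setTI; exact: mf.
Qed.

Lemma geometric_bound_sum_lty (u : nat -> \bar R) (K z : R) :
  0 <= z < 1 -> (forall n, (0 <= u n <= (K * z ^+ n)%:E)%E) ->
  (\sum_(n <oo) u n < +oo)%E.
Proof.
move=> /andP[z0 z1] uK.
have K0 : 0 <= K.
  have /andP[u0 uK0] := uK 0%N.
  by have := le_trans u0 uK0; rewrite lee_fin expr0 mulr1.
apply: (@le_lt_trans _ _ (K / (1 - z))%:E); last exact: ltry.
apply: lime_le; first by apply: is_cvg_nneseries => n _ _; have /andP[] := uK n.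
apply: nearW => n; apply: (@le_trans _ _ (\sum_(0 <= k < n) (K * z ^+ k)%:E)%E).
  by apply: lee_sum => k _; have /andP[] := uK k.
rewrite sumEFin lee_fin.
have -> : \sum_(0 <= k < n) K * z ^+ k = series (geometric K z) n by [].
rewrite geometric_seriesE ?lt_eqF//= ler_pM2r ?invr_gt0 ?subr_gt0//.
by rewrite ler_piMr// gerBl exprn_ge0.
Qed.

Local Open Scope ereal_scope.

(** With M = E (s 0)^a < 1, the a-th power of the product of n factors has
expectation M^n; Markov's inequality at level q^n with M < q < 1 gives summable
probabilities, and r is the power of q that absorbs the exponent a. *)
Lemma iid_prod_exponentially_small (C : R) (s : nat -> T -> R) : (1 <= C)%R ->
  (forall k, measurable_fun setT (s k)) -> iid P s ->
  (forall k t, 0 <= s k t <= C)%R ->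
  \int[P]_t lne (s 0%N t)%:E < 0 ->
  exists2 r : R, (0 < r < 1)%R &
    {ae P, forall t, \forall n \near \oo, (\prod_(k < n) s k t < r ^+ n)%R}.
Proof.
move=> C1 ms si sC phi0.
have [a a0 moment] := exists_powR_moment_lt1 C1 (ms 0%N) (sC 0%N) phi0.
have mpow : measurable_fun setT (fun x : R => x `^ a)%R by exact: measurable_powR.
have mnorm : measurable_fun setT (fun x : R => `|x|%:E).
  by apply/measurable_EFinP; exact: normr_measurable.
pose g (z : R * R) := (z.1 * z.2 `^ a)%R.
have mg : measurable_fun setT g.
  by apply: measurable_funM => //; exact: (measurableT_comp mpow).
pose p := recursion g 1%R s.
have mp n : measurable_fun setT (p n) by exact: measurable_recursion.
have pE n t : p n t = ((\prod_(k < n) s k t) `^ a)%R.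
  elim: n => [|n ih]; first by rewrite big_ord0 powR1.
  rewrite /p /= -/(p n t) ih big_ord_recr/= powRM//; last by have /andP[] := sC n t.
  by apply: prodr_ge0 => k _; have /andP[] := sC k t.
have p0 n t : (0 <= p n t)%R by rewrite pE powR_ge0.
pose M := \int[P]_t (s 0%N t `^ a)%:E.
have M0 : 0 <= M by apply: integral_ge0 => t _; rewrite lee_fin powR_ge0.
have Mfin : M \is a fin_num by rewrite ge0_fin_numE// (lt_trans moment)// ltry.
have Ip n : \int[P]_t `|p n t|%:E = (fine M ^+ n)%:E.
  elim: n => [|n ih].
    rewrite (eq_integral (cst 1)); last by move=> t _; rewrite /p/= normr1.
    exact: integral_cst_probability.
  rewrite exprSr EFinM fineK// -ih -(@integral_recursion_mul _ _ _ P s g 1%R ms mg si n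
    (fun x => `|x|%:E) (fun x => (x `^ a)%:E))//; last first.
  - by move=> x; rewrite lee_fin powR_ge0.
  - exact/measurable_EFinP.
  apply: eq_integral => t _.
  by rewrite -EFinM /p/= normrM (ger0_norm (powR_ge0 _ _)).
set m := fine M in Ip.
have m0 : (0 <= m)%R by exact: fine_ge0.
have m1 : (m < 1)%R by rewrite -lte_fin fineK.
have [q [q0 q1 mq]] : exists q : R, [/\ (0 < q)%R, (q < 1)%R & (m < q)%R].
  by exists ((1 + m) / 2)%R; split; lra.
have [r r0 rq] : exists2 r, (0 < r < 1)%R & forall n, ((r ^+ n) `^ a = q ^+ n)%R.
  exists (q `^ a^-1)%R.
    rewrite powR_gt0//=; have : (q `^ a^-1 < 1 `^ a^-1)%R.
      by rewrite gt0_ltr_powR ?invr_gt0// ?nnegrE ?ltW.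
    by rewrite powR1.
  move=> n; rewrite -[((q `^ a^-1) ^+ n)%R]powR_mulrn ?powR_ge0// -!powRrM.
  by rewrite [(n%:R * a)%R]mulrC mulrA mulVf ?gt_eqF// mul1r powR_mulrn// ltW.
exists r => //.
pose F n := [set t | (q ^+ n)%:E <= `|(p n t)%:E|].
have mF n : measurable (F n).
  rewrite -[F n]setTI; apply: emeasurable_fun_c_infty => //.
  by apply: measurableT_comp => //; exact/measurable_EFinP.
have PF n : P (F n) <= (1 * (m / q) ^+ n)%:E.
  have qn : (0 < q ^+ n)%R by rewrite exprn_gt0.
  have := le_integral_abse P measurableT ((measurable_EFinP _ _).2 (mp n)) qn.
  rewrite setTI /= Ip mul1r => h.
  by rewrite expr_div_n mulrC EFinM lee_pdivlMl.
have sumF : \sum_(n <oo) P (F n) < +oo.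
  apply: (@geometric_bound_sum_lty _ 1 (m / q)).
    by rewrite divr_ge0//= ?ltr_pdivrMr ?mul1r// ltW.
  by move=> n; rewrite PF measure_ge0.
apply: filterS (borel_cantelli_ae mF sumF) => t; apply: filterS => n.
rewrite /F /= ger0_norm// lee_fin => /negP; rewrite -ltNge pE -rq.
have s0 : (0 <= \prod_(k < n) s k t)%R.
  by apply: prodr_ge0 => k _; have /andP[] := sC k t.
have rn0 : (0 <= r ^+ n)%R by rewrite exprn_ge0// ltW//; case/andP: r0.
apply: contraTT; rewrite -!leNgt => h.
by rewrite ge0_ler_powR// ?nnegrE// ltW.
Qed.

End exponential_decay.

(** * Nonnegative drift: products that do not converge *)

Section divergence.
Context {d : measure_display} {T : measurableType d} {R : realType}
  (P : probability T R).
Local Open Scope ereal_scope.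

Lemma lne_mulr_ge0 (x y : R) : (0 <= x)%R -> (0 <= y)%R ->
  lne (x * y)%:E = lne x%:E + lne y%:E.
Proof.
move=> x0 y0; have [->|xn0] := eqVneq x 0%R.
  by rewrite mul0r le0_lneNy.
have [->|yn0] := eqVneq y 0%R.
  by rewrite mulr0 [in RHS](@le0_lneNy _ 0%:E)// le0_lneNy// addeC.
by rewrite EFinM lneM// in_itv/= ?leey ?andbT lte_fin lt_neqAle eq_sym ?xn0 ?yn0.
Qed.

Variables (C : R) (s : nat -> T -> R).
Hypothesis C1 : (1 <= C)%R.
Hypothesis ms : forall k, measurable_fun setT (s k).
Hypothesis si : iid P s.

(** The process p K is the product stopped when it first exceeds K; it is at
most K * C when K >= 1.  Since the increments of the logarithm have nonnegative
mean, the expectation of V = log (K * C) - log (p K) does not increase, so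
Fatou's lemma makes its lower limit finite almost surely.  A product tending to 0
is bounded by some K, hence never stopped, and would send V to +oo. *)
Lemma iid_prod_not_cvg0 : (forall k t, 0 <= s k t <= C)%R ->
  0 <= \int[P]_t lne (s 0%N t)%:E ->
  {ae P, forall t, ~ (\prod_(k < n) s k t @[n --> \oo] --> (0:R))%R}.
Proof.
move=> sC phi0.
have s0 k t : (0 <= s k t)%R by have /andP[] := sC k t.
have sC' k t : (s k t <= C)%R by have /andP[] := sC k t.
have C0 : (0 < C)%R by exact: lt_le_trans C1.
have lneC k t : lne (s k t)%:E <= (ln C)%:E.
  rewrite -lne_EFin// lee_lne ?in_itv/= ?leey ?andbT ?lee_fin//; exact: ltW.
pose g K (z : R * R) := if (z.1 <= K%:R)%R then (z.1 * z.2)%R else z.1.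
have mg K : measurable_fun setT (g K).
  apply: measurable_fun_ifT => //=; first exact: measurable_fun_ler.
  exact: measurable_funM.
pose p K := recursion (g K) 1%R s.
have mp K n : measurable_fun setT (p K n) by exact: measurable_recursion.
have p0 K n t : (0 <= p K n t)%R.
  elim: n => [|n ih]; first exact: ler01.
  by rewrite /p/= /g/= -/(p K n t); case: ifP => _ //; exact: mulr_ge0.
have pC K n t : (0 < K)%N -> (p K n t <= K%:R * C)%R.
  move=> K0; have K1 : (1 <= K%:R :> R)%R by rewrite ler1n.
  elim: n => [|n ih].
    by rewrite -[leLHS]mulr1 ler_pM.
  by rewrite /p/= /g/= -/(p K n t); case: ifP => // pK; exact: ler_pM.
pose V K n t := (ln (K%:R * C))%:E - lne (p K n t)%:E.
have mV K n : measurable_fun setT (V K n).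
  by apply: emeasurable_funB => //; exact: measurable_lne.
have V0 K n t : (0 < K)%N -> 0 <= V K n t.
  move=> K0; rewrite sube_ge0 ?orbT// -lne_EFin; last first.
    by rewrite mulr_gt0// ltr0n.
  rewrite lee_lne ?in_itv/= ?leey ?andbT ?lee_fin//; first exact: pC.
  by rewrite mulr_ge0// ltW.
pose h K (x : R) : \bar R := if (x <= K%:R)%R then 1 else 0.
have mh K : measurable_fun setT (h K).
  by apply: measurable_fun_ifT => //=; exact: measurable_fun_ler.
have h0 K x : 0 <= h K x by rewrite /h; case: ifP.
have mhp K n : measurable_fun setT (fun t => h K (p K n t)).
  exact: (measurableT_comp (mh K)).
pose k (x : R) : \bar R := maxe 0 ((ln C)%:E - lne x%:E).
have k0 x : 0 <= k x by rewrite /k le_max lexx.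
have mk : measurable_fun setT k.
  apply: measurable_maxe => //; apply: emeasurable_funB => //.
  exact: measurable_lne.
have ks n t : k (s n t) = (ln C)%:E - lne (s n t)%:E.
  by rewrite /k; apply/max_idPr; rewrite sube_ge0 ?orbT.
(* Adding log C on both sides keeps every term nonnegative or +oo, so that the
expectations can be split without integrability. *)
have step K n t : (0 < K)%N -> V K n.+1 t + h K (p K n t) * (ln C)%:E =
    V K n t + h K (p K n t) * k (s n t).
  move=> K0; rewrite ks /V /h.
  have -> : p K n.+1 t = if (p K n t <= K%:R)%R then (p K n t * s n t)%R
    else p K n t by [].
  case: ifP => _; last first.
    by rewrite !mul0e.
  rewrite !mul1e lne_mulr_ge0//.
  have : lne (p K n t)%:E != +oo by rewrite /lne; case: ifP.
  have := lneC n t; case: (lne (s n t)%:E) => [b| |]//;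
    case: (lne (p K n t)%:E) => [a| |]// _ _.
  by rewrite -!(EFinB, EFinD); congr EFin; ring.
have Ik : \int[P]_t k (s 0%N t) <= (ln C)%:E.
  rewrite (eq_integral (fun t => (ln C)%:E - lne (s 0%N t)%:E)); last first.
    by move=> t _; rewrite ks.
  rewrite integral_cstB//; [|exact: ln_ge0|exact: measurable_lne].
  by rewrite -[leRHS]adde0 leeD2l// oppe_le0.
have IV K n : (0 < K)%N -> \int[P]_t V K n t <= (ln (K%:R * C))%:E.
  move=> K0; elim: n => [|n ih].
    rewrite (eq_integral (fun=> (ln (K%:R * C))%:E)); last first.
      by move=> t _; rewrite /V /= ifF ?ln1 ?sube0// lt_geF.
    by rewrite integral_cst_probability.
  have lnC0 : (0 <= ln C)%R by exact: ln_ge0.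
  have hC0 t : 0 <= h K (p K n t) * (ln C)%:E by rewrite mule_ge0.
  have hk0 t : 0 <= h K (p K n t) * k (s n t) by rewrite mule_ge0.
  pose Ih := \int[P]_t h K (p K n t).
  have Ih0 : 0 <= Ih by exact: integral_ge0.
  have Ih1 : Ih <= 1.
    rewrite -[leRHS](integral_cst_probability P).
    by apply: ge0_le_integral => //= t _; rewrite /h; case: ifP.
  have Ihfin : Ih \is a fin_num by rewrite ge0_fin_numE// (le_lt_trans Ih1)// ltry.
  have : \int[P]_t V K n.+1 t + Ih * (ln C)%:E <=
      \int[P]_t V K n t + Ih * (ln C)%:E.
    rewrite -ge0_integralZr//.
    rewrite -ge0_integralD//; last 2 first.
    - by move=> t _; exact: V0.
    - exact: emeasurable_funM.
    under eq_integral do rewrite step//.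
    rewrite ge0_integralD//; last 2 first.
    - by move=> t _; exact: V0.
    - by apply: emeasurable_funM => //; exact: measurableT_comp.
    rewrite leeD2l// integral_recursion_mul//.
    by rewrite ge0_integralZr// lee_wpmul2l.
  rewrite leeD2rE ?fin_numM// => le_; exact: le_trans ih.
have aeK K : {ae P, forall t, (0 < K)%N ->
    limn_einf (fun n => V K n t) \is a fin_num}.
  have [->|K0] := posnP K; first exact: aeW.
  have mlim : measurable_fun setT (fun t => limn_einf (fun n => V K n t)).
    rewrite /limn_einf; apply: measurableT_comp => //.
    by apply: measurable_fun_limn_esup => n; exact: measurableT_comp.
  have lim0 t : 0 <= limn_einf (fun n => V K n t).
    rewrite limn_einf_lim; apply: lime_ge; first exact: is_cvg_einfs.
    by apply: nearW => n; apply: le_ereal_inf_tmp => _ [m _ <-]; exact: V0.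
  have : P.-integrable setT (fun t => limn_einf (fun n => V K n t)).
    apply/integrableP; split => //.
    under eq_integral do rewrite gee0_abs//.
    have le_ := @fatou _ _ _ P setT measurableT (V K).
    have {}le_ := le_ (mV K) (fun n t _ => V0 K n t K0).
    apply: (le_lt_trans le_); apply: (@le_lt_trans _ _ (ln (K%:R * C))%:E).
      rewrite limn_einf_lim; apply: lime_le; first exact: is_cvg_einfs.
      apply: nearW => n; apply: le_trans (IV K n K0).
      by apply: ereal_inf_lbound; exists n => /=.
    exact: ltry.
  move/integrable_ae => /(_ measurableT); apply: filterS => t /(_ I) ? _.
  by [].
apply: filterS (ae_foralln aeK) => t tK prod0.
have [B Bpos Bge] : exists2 B : nat, (0 < B)%N &
    forall n, (\prod_(k < n) s k t <= B%:R)%R.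
  have [B [_ BB]] : bounded_fun (fun n => \prod_(k < n) s k t)%R.
    by apply: cvg_seq_bounded; apply/cvg_ex; exists 0%R.
  exists (Num.truncn (B + 1)).+1 => // n.
  have := BB (B + 1)%R; rewrite ltrDl ltr01 => /(_ isT n I) /= hB.
  apply: le_trans (ler_norm _) (le_trans hB _); exact: ltW (truncnS_gt _).
have pE n : p B n t = (\prod_(k < n) s k t)%R.
  elim: n => [|n ih]; first by rewrite big_ord0.
  by rewrite /p/= /g/= -/(p B n t) ih Bge big_ord_recr.
have := tK B Bpos.
suff -> : limn_einf (fun n => V B n t) = +oo by [].
apply: (cvg_limn_einf_sup _).1.
apply/cvgeyPge => A.
pose e := expR (ln (B%:R * C) - A).
have e0 : (0 < e)%R by exact: expR_gt0.
have := prod0; move/cvgrPdist_lt => /(_ _ e0); apply: filterS => n /=.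
rewrite sub0r normrN -pE ger0_norm// => pe.
rewrite /V; have [->|pn0] := eqVneq (p B n t) 0%R.
  by rewrite le0_lneNy// addey// leey.
have pgt0 : (0 < p B n t)%R by rewrite lt_neqAle eq_sym pn0 p0.
rewrite lne_EFin// -EFinB lee_fin.
have : (ln (p B n t) <= ln e)%R by rewrite ler_ln// ?posrE// ltW.
by rewrite /e expRK; lra.
Qed.

(** Some neighbourhood D j of 1 has probability less than 1 under the law of
s 0, and independence makes it impossible to stay in it forever. *)
Lemma iid_not_cvg1 : P (s 0%N @^-1` [set 1%R]) < 1 ->
  {ae P, forall t, ~ (s n t @[n --> \oo] --> (1:R))%R}.
Proof.
move=> P1.
pose D j := [set x : R | (`|x - 1| <= j.+1%:R^-1)%R].
have mD j : measurable (D j).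
  rewrite -[D j]setTI; apply: measurable_fun_ler => //.
  apply: measurableT_comp => //; exact: measurable_funB.
have mDs j : measurable (s 0%N @^-1` D j).
  by rewrite -[X in measurable X]setTI; exact: ms.
have [j Pj] : exists j, P (s 0%N @^-1` D j) < 1.
  apply: contrapT => nj; move: P1; rewrite ltNge => /negP; apply.
  have Pj j : P (s 0%N @^-1` D j) = 1.
    apply/eqP; rewrite eq_le probability_le1//= leNgt; apply/negP => hj.
    by apply: nj; exists j.
  have -> : s 0%N @^-1` [set 1%R] = \bigcap_j (s 0%N @^-1` D j).
    apply/seteqP; split => [t /= st1 j _ /=|t /= tD].
      by rewrite /D/= st1 subrr normr0.
    apply/eqP; rewrite -subr_eq0 -normr_le0; apply/ler_addgt0Pl => e e0.
    rewrite addr0; have := tD (Num.truncn e^-1) I; rewrite /D /= => /le_trans; apply.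
    rewrite -[leRHS]invrK lef_pV2 ?posrE ?invr_gt0//.
    exact: ltW (truncnS_gt _).
  have cv : P (s 0%N @^-1` D n) @[n --> \oo] --> P (\bigcap_j (s 0%N @^-1` D j)).
    apply: nonincreasing_cvg_mu => //.
    - by rewrite [ltLHS](Pj 0%N) ltry.
    - exact: bigcapT_measurable.
    - move=> a b ab; apply/subsetPset => t /=; rewrite /D/= => /le_trans; apply.
      by rewrite lef_pV2 ?posrE// ler_nat ltnS.
  have Pcst : (fun n => P (s 0%N @^-1` D n)) = (fun=> 1) by exact/funext.
  suff -> : P (\bigcap_j (s 0%N @^-1` D j)) = 1 by [].
  rewrite Pcst in cv.
  by apply: (cvg_unique _ cv); [exact: ereal_hausdorff|exact: cvg_cst].
pose E n := \bigcap_k (s (n + k)%N @^-1` D j).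
have mE n : measurable (E n).
  apply: bigcapT_measurable => k.
  by rewrite -[X in measurable X]setTI; exact: ms.
have PE n : P (E n) = 0.
  pose q := fine (P (s 0%N @^-1` D j)).
  have qE : P (s 0%N @^-1` D j) = q%:E.
    by rewrite fineK// fin_num_measure.
  have q0 : (0 <= q)%R by exact: fine_ge0.
  have q1 : (q < 1)%R by rewrite -lte_fin -qE.
  have Eq N : P (E n) <= (q ^+ N)%:E.
    have mfst : measurable_fun setT (fst : R * R -> R) by exact: measurable_fst.
    have := recursion_indep_future 0%R ms mfst si n N measurableT (fun=> mD j).
    rewrite preimage_setT setTI probability_setT mul1e.
    under eq_bigr do rewrite qE.
    rewrite prodEFin prodr_const card_ord => <-.
    apply: le_measure; rewrite ?inE//; last by move=> t Et k _; exact: Et.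
    apply: fin_bigcap_measurable => // k _.
    by rewrite -[X in measurable X]setTI; exact: ms.
  apply/eqP; rewrite -measure_le0.
  have cv : (q ^+ N)%:E @[N --> \oo] --> 0.
    by apply/fine_cvgP; split; [exact: nearW|apply: cvg_expr; rewrite ger0_norm].
  have <- : limn (fun N => (q ^+ N)%:E) = 0 by exact/cvg_lim.
  by apply: lime_ge; [apply/cvg_ex; exists 0|exact: nearW].
have : {ae P, forall t, forall n, ~ E n t}.
  apply: ae_foralln => n; exists (E n); split=> [//||t /= /contrapT //].
  exact: PE.
apply: filterS => t nE cv1.
have j0 : (0 < j.+1%:R^-1 :> R)%R by rewrite invr_gt0.
move/cvgrPdist_le : cv1 => /(_ _ j0)[n _ hn]; apply: (nE n) => k _.
rewrite /D /= distrC; apply: hn => /=; exact: leq_addr.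
Qed.

End divergence.

Section nonconvergence.
Context {d : measure_display} {T : measurableType d} {R : realType}
  (P : probability T R).

(** The ratio of consecutive partial products is s n, so a nonzero limit would
force s n to tend to 1. *)
Lemma iid_prod_not_cvg (C : R) (s : nat -> T -> R) : 1 <= C ->
  (forall k, measurable_fun setT (s k)) -> iid P s ->
  (forall k t, `|s k t| <= C) ->
  (0 <= \int[P]_t lne `|s 0%N t|%:E)%E -> (P (s 0%N @^-1` [set 1%R]) < 1)%E ->
  {ae P, forall t, ~ cvgn (fun n => \prod_(k < n) s k t)}.
Proof.
move=> C1 ms si sC phi0 P1.
have mnorm : measurable_fun setT (fun x : R => `|x|) by exact: normr_measurable.
have ns0 k t : 0 <= `|s k t| <= C by rewrite normr_ge0 sC.
have ae0 := iid_prod_not_cvg0 C1 (fun k => measurableT_comp mnorm (ms k))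
  (iid_comp mnorm si) ns0 phi0.
apply: filterS2 ae0 (iid_not_cvg1 ms si P1) => t n0 n1.
set S := (fun n => \prod_(k < n) s k t) => /cvg_ex[/= c Sc].
have [c0|c0] := eqVneq c 0.
  apply: n0; under eq_fun do rewrite -normr_prod.
  by rewrite -(@normr0 _ R) -c0; exact: cvg_norm.
apply: n1.
have ratio : S n.+1 / S n @[n --> \oo] --> (1:R).
  rewrite -(divff c0); apply: cvgM; first by rewrite cvg_shiftS.
  exact: cvgV.
apply: cvg_trans ratio; apply: near_eq_cvg.
have : \forall n \near \oo, S n != 0.
  exact: (cvgr_neq0 _ Sc).
apply: filterS => n Sn0.
by rewrite /S big_ord_recr/= -/(S n) mulrAC divff// mul1r.
Qed.

End nonconvergence.

(** * Addresses of points in the nested partitions *)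

Section coding.
Context {R : realType} {m : nat} (b : nat -> R) (i0 : 'I_m).
Hypothesis hb : is_partition m b.

Lemma len_gt0 (i : 'I_m) : 0 < len b i.
Proof. by rewrite subr_gt0; case: hb => _ _; exact. Qed.

Lemma partition_le i j : (i <= j)%N -> (j <= m)%N -> b i <= b j.
Proof.
elim: j => [|j ih]; first by rewrite leqn0 => /eqP->.
rewrite leq_eqVlt => /predU1P[->//|ij jm].
by rewrite (le_trans (ih ij (ltnW jm)))// ltW//; case: hb => _ _; exact.
Qed.

Lemma partition_itv01 (i : 'I_m) : 0 <= b i /\ b i.+1 <= 1.
Proof.
have [b0 b1 _] := hb; rewrite -b0 -b1; split; apply: partition_le => //.
exact: ltnW.
Qed.

Lemma sum_len : \sum_(i < m) len b i = 1.
Proof.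
have [b0 b1 _] := hb; have := telescope_sumr b (leq0n m).
by rewrite b0 b1 subr0 big_mkord.
Qed.

Lemma exists_len_lbound : exists2 c, 0 < c <= 1 & forall i : 'I_m, c <= len b i.
Proof.
exists (\big[Num.min/1]_(i < m) len b i).
  rewrite bigmin_le_id andbT lt_bigmin// => i _; exact: len_gt0.
by move=> i; exact: bigmin_le_cond.
Qed.

(** The index i0 is the junk value outside [0, 1[. *)
Definition digit (x : R) : 'I_m :=
  xget i0 [set i : 'I_m | b i <= x < b i.+1].

Lemma digit_uniq (i : 'I_m) x : b i <= x < b i.+1 -> digit x = i.
Proof.
move=> xi; rewrite /digit; case: xgetP => [j _ /= xj|/(_ i)//].
apply/val_inj/eqP; rewrite eqn_leq; apply/andP; split; rewrite leqNgt;
  apply/negP => lt_.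
- have := partition_le lt_ (ltnW (ltn_ord j)).
  by case/andP: xi => _ xi; case/andP: xj => xj _; rewrite leNgt (le_lt_trans xj xi).
- have := partition_le lt_ (ltnW (ltn_ord i)).
  by case/andP: xj => _ xj; case/andP: xi => xi _; rewrite leNgt (le_lt_trans xi xj).
Qed.

Lemma digitP x : 0 <= x < 1 -> b (digit x) <= x < b (digit x).+1.
Proof.
have [b0 b1 _] := hb; move=> /andP[x0 x1].
suff [i ix] : exists i : 'I_m, b i <= x < b i.+1 by rewrite (digit_uniq ix).
have : exists n, x < b n by exists m; rewrite b1.
move=> /ex_minnP[[|i] xi imin]; first by rewrite b0 ltNge x0 in xi.
have im : (i < m)%N by apply: imin; rewrite b1.
exists (Ordinal im); rewrite xi andbT leNgt; apply/negP => /imin.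
by rewrite ltnn.
Qed.

Definition shift (x : R) : R := (x - b (digit x)) / len b (digit x).

Lemma shift_ge0_lt1 x : 0 <= x < 1 -> 0 <= shift x < 1.
Proof.
move=> /digitP/andP[h1 h2]; rewrite /shift; have l0 := len_gt0 (digit x).
apply/andP; split; first by rewrite divr_ge0 ?(ltW l0)// subr_ge0.
by rewrite ltr_pdivrMr// mul1r /len ltrD2r.
Qed.

Lemma iter_shift_ge0_lt1 n x : 0 <= x < 1 -> 0 <= iter n shift x < 1.
Proof. by move=> x01; elim: n => // n; exact: shift_ge0_lt1. Qed.

Fixpoint word (n : nat) (x : R) : seq 'I_m :=
  if n is k.+1 then digit x :: word k (shift x) else [::].

Lemma size_word n x : size (word n x) = n.
Proof. by elim: n x => //= n ih x; rewrite ih. Qed.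

Lemma wordS n x : word n.+1 x = rcons (word n x) (digit (iter n shift x)).
Proof. by elim: n x => //= n ih x; rewrite ih -iterSr. Qed.

Lemma take_word k n x : (k <= n)%N -> take k (word n x) = word k x.
Proof. by elim: n k x => [|n ih] [|k] x //= kn; rewrite ih. Qed.

Lemma nth_word k n x : (k < n)%N -> nth i0 (word n x) k = digit (iter k shift x).
Proof.
by elim: n k x => [|n ih] [|k] x //= kn; rewrite ih// -iterSr.
Qed.

(** The length of the interval of points whose address begins with w. *)
Definition wlen (w : seq 'I_m) : R := \prod_(i <- w) len b i.

Lemma wlen_gt0 w : 0 < wlen w.
Proof. by apply: prodr_gt0 => i _; exact: len_gt0. Qed.

(** The affine map of [0, 1] onto the closed interval of address w; it is the
action of a composition of the random maps on first coordinates. *)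
Fixpoint zoom (w : seq 'I_m) (z : R) : R :=
  if w is i :: w' then len b i * zoom w' z + b i else z.

Lemma zoomE w z : zoom w z = wlen w * z + zoom w 0.
Proof.
elim: w => [|i w /= ->] /=; first by rewrite /wlen big_nil mul1r addr0.
by rewrite /wlen big_cons; ring.
Qed.

Lemma zoom_word n x : zoom (word n x) (iter n shift x) = x.
Proof.
elim: n x => //= n ih x; rewrite -iterS iterSr ih /shift mulrC divfK ?subrK//.
by rewrite gt_eqF ?len_gt0.
Qed.

Lemma zoom_itvco w z : 0 <= z < 1 -> 0 <= zoom w z < 1.
Proof.
move=> z01; elim: w => //= i w /andP[h0 h1].
have [bi0 bi1] := partition_itv01 i; have l0 := len_gt0 i.
rewrite addr_ge0 ?mulr_ge0 ?(ltW l0)//=.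
rewrite (lt_le_trans _ bi1)// -ltrBrDr -/(len b i) -[ltRHS]mulr1.
by rewrite ltr_pM2l.
Qed.

Lemma zoom_itvoo w z : 0 < z < 1 -> 0 < zoom w z < 1.
Proof.
move=> /andP[z0 z1].
have z01 : 0 <= z < 1 by rewrite ltW.
have o01 : 0 <= (0 : R) < 1 by rewrite lexx ltr01.
have /andP[_ ->] := zoom_itvco w z01; have /andP[w0 _] := zoom_itvco w o01.
by rewrite zoomE andbT ltr_wpDr// mulr_gt0// wlen_gt0.
Qed.

Lemma zoom_itvcc w z : 0 <= z <= 1 -> 0 <= zoom w z <= 1.
Proof.
move=> z01; elim: w => //= i w /andP[h0 h1].
have [bi0 bi1] := partition_itv01 i; have l0 := len_gt0 i.
rewrite addr_ge0 ?mulr_ge0 ?(ltW l0)//=.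
rewrite (le_trans _ bi1)// -lerBrDr -/(len b i) -[leRHS]mulr1.
by rewrite ler_pM2l.
Qed.

Lemma digit_affine (i : 'I_m) z : 0 <= z < 1 -> digit (len b i * z + b i) = i.
Proof.
move=> /andP[z0 z1]; apply: digit_uniq; have l0 := len_gt0 i.
rewrite lerDr mulr_ge0 ?(ltW l0)//= -ltrBrDr -/(len b i) -[ltRHS]mulr1.
by rewrite ltr_pM2l.
Qed.

Lemma shift_affine (i : 'I_m) z : 0 <= z < 1 -> shift (len b i * z + b i) = z.
Proof.
move=> z01; rewrite /shift digit_affine// addrK mulrAC divff ?mul1r//.
by rewrite gt_eqF ?len_gt0.
Qed.

Lemma word_zoom w z : 0 <= z < 1 -> word (size w) (zoom w z) = w.
Proof.
move=> z01; elim: w => //= i w ih.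
by rewrite shift_affine ?digit_affine ?ih// zoom_itvco.
Qed.

Lemma iter_shift_zoom w z : 0 <= z < 1 -> iter (size w) shift (zoom w z) = z.
Proof.
move=> z01; elim: w => //= i w ih.
by rewrite -iterS iterSr shift_affine ?ih// zoom_itvco.
Qed.

(** A point that is not an endpoint has only one address of each length. *)
Lemma zoom_inj w w' z z' : size w = size w' -> 0 < z < 1 -> 0 <= z' <= 1 ->
  zoom w z = zoom w' z' -> w = w'.
Proof.
move=> + z01 z01'; elim: w w' => [[]//|i w ih [//|j w'] /= [ww'] E].
have /andP[u0 u1] := zoom_itvoo w z01.
have /andP[v0 v1] := zoom_itvcc w' z01'.
have li := len_gt0 i; have lj := len_gt0 j.
have ij : i = j.
  apply/val_inj/eqP; rewrite eqn_leq; apply/andP; split; rewrite leqNgt;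
    apply/negP => lt_.
  - have := partition_le lt_ (ltnW (ltn_ord i)); rewrite leNgt => /negP; apply.
    have : len b j * zoom w' z' <= len b j by rewrite ger_pMr.
    have : 0 < len b i * zoom w z by exact: mulr_gt0.
    by move: E; rewrite /len; lra.
  - have := partition_le lt_ (ltnW (ltn_ord j)); rewrite leNgt => /negP; apply.
    have : len b i * zoom w z < len b i by rewrite gtr_pMr.
    have : 0 <= len b j * zoom w' z' by rewrite mulr_ge0// ltW.
    by move: E; rewrite /len; lra.
by rewrite -ij in E *; congr (_ :: _); apply: ih => //;
  move/addIr/(mulfI (lt0r_neq0 li)) : E.
Qed.

Lemma wlen_word_cvg0 x : (1 < m)%N ->
  wlen (word n x) @[n --> \oo] --> (0:R).
Proof.
move=> m1; have [c /andP[c0 c1] cl] := exists_len_lbound.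
have lc (i : 'I_m) : len b i <= 1 - c.
  have [j ji] : exists j : 'I_m, j != i.
    have m0 : (0 < m)%N by exact: ltnW.
    have [i_0|i_0] := eqVneq (val i) 0%N.
      by exists (Ordinal m1); rewrite -val_eqE/= i_0.
    by exists (Ordinal m0); rewrite -val_eqE/= eq_sym.
  have := sum_len; rewrite (bigD1 i)//= (bigD1 j)//=.
  have : 0 <= \sum_(k < m | (k != i) && (k != j)) len b k.
    by apply: sumr_ge0 => k _; rewrite ltW// len_gt0.
  by have := cl j; lra.
have le_ n : wlen (word n x) <= (1 - c) ^+ n.
  elim: n => [|n ih]; first by rewrite /wlen big_nil.
  rewrite wordS /wlen -cats1 big_cat big_seq1 exprSr ler_pM//.
    by rewrite ltW// wlen_gt0.
  by rewrite ltW// len_gt0.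
apply: (@squeeze_cvgr _ _ _ _ (fun=> 0) (fun n => (1 - c) ^+ n)).
- by apply: nearW => n; rewrite le_ ltW// wlen_gt0.
- exact: cvg_cst.
- by apply: cvg_expr; rewrite ger0_norm; lra.
Qed.

End coding.

(** * Lebesgue measure in terms of addresses *)

Section finite_partition.
Context {d d' : measure_display} {T : measurableType d} {U : measurableType d'}
  {R : realType} {I : finType} (c : T -> I).
Hypothesis mc : forall i, measurable (c @^-1` [set i]).

Lemma measurable_fun_fibers (f : I -> T -> U) :
  (forall i, measurable_fun setT (f i)) ->
  measurable_fun setT (fun x => f (c x) x).
Proof.
move=> mf _ B mB; rewrite setTI.
have -> : (fun x => f (c x) x) @^-1` B =
    \bigcup_(i in [set: I]) (c @^-1` [set i] `&` f i @^-1` B).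
  apply/seteqP; split => [x /= fB|x [i _ [/= <-]]//].
  by exists (c x).
apply: fin_bigcup_measurable => // i _; apply: measurableI => //.
by rewrite -[X in measurable X]setTI; exact: mf.
Qed.

Lemma measure_fibers (mu : {measure set T -> \bar R}) (E : set T) :
  measurable E -> mu E = (\sum_(i : I) mu (E `&` c @^-1` [set i]))%E.
Proof.
move=> mE.
have {1}-> : E = \bigcup_(i in [set: I]) (E `&` c @^-1` [set i]).
  apply/seteqP; split => [x Ex|x [i _ []]//].
  by exists (c x).
rewrite measure_fin_bigcup; last 3 first.
- exact: finite_finset.
- by move=> i j _ _ [x [[_ /= <-] [_ /= <-]]].
- by move=> i _; exact: measurableI.
have -> : [set: I] = [set` xpredT] by apply/seteqP; split.
rewrite -(@bigfs _ _ _ _ (index_enum I)) ?index_enum_uniq// => i _.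
by rewrite mem_index_enum.
Qed.

Lemma ge0_integral_fibers (mu : {measure set T -> \bar R}) (f : I -> \bar R) :
  (forall i, 0 <= f i)%E ->
  (\int[mu]_x f (c x) = \sum_(i : I) f i * mu (c @^-1` [set i]))%E.
Proof.
move=> f0.
transitivity (\int[mu]_x \sum_(i : I) f i * (\1_(c @^-1` [set i]) x)%:E)%E.
  apply: eq_integral => x _; rewrite (bigD1 (c x))//= big1 ?adde0.
    by rewrite indicE mem_set// mule1.
  move=> i ic; rewrite indicE memNset ?mule0//= => ci.
  by move: ic; rewrite ci eqxx.
rewrite ge0_integral_sum//; last 2 first.
- move=> i; apply: emeasurable_funM => //.
  by apply/measurable_EFinP; exact: measurable_indic.
- by move=> i x _; rewrite mule_ge0// lee_fin.
apply: eq_bigr => i _; rewrite ge0_integralZl//.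
  by rewrite integral_indic// setIT.
by apply/measurable_EFinP; exact: measurable_indic.
Qed.

End finite_partition.

Lemma sum_tuple_prod (R : comPzSemiRingType) (J : finType) (n : nat)
    (f : nat -> J -> R) :
  \sum_(w : n.-tuple J) \prod_(k < n) f k (tnth w k) =
  \prod_(k < n) \sum_(i : J) f k i.
Proof.
rewrite bigA_distr_bigA /= (reindex (fun g : {ffun 'I_n -> J} => [tuple g k | k < n])).
  by apply: eq_bigr => g _; apply: eq_bigr => k _; rewrite tnth_mktuple.
exists (fun w => [ffun k => tnth w k]) => [g _|w _].
  by apply/ffunP => k; rewrite ffunE tnth_mktuple.
by apply: eq_from_tnth => k; rewrite tnth_mktuple ffunE.
Qed.

Definition unit_lebesgue {R : realType} : set (measurableTypeR R) -> \bar R :=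
  mrestr lebesgue_measure (measurable_itv `[(0:R), 1[).

HB.instance Definition _ (R : realType) := Measure.on (@unit_lebesgue R).

Lemma unit_lebesgue_setT (R : realType) : unit_lebesgue [set: measurableTypeR R] = 1%E.
Proof.
rewrite /unit_lebesgue /mrestr setTI lebesgue_measure_itv/= lte_fin ltr01.
by rewrite -EFinB subr0.
Qed.

HB.instance Definition _ (R : realType) :=
  Measure_isProbability.Build _ _ _ (@unit_lebesgue R) (@unit_lebesgue_setT R).

Section coding_measure.
Context {R : realType} {m : nat} (b : nat -> R) (i0 : 'I_m).
Hypothesis hb : is_partition m b.
Local Notation dig := (digit b i0).
Local Notation shf := (shift b i0).
Local Notation wrd := (word b i0).

Lemma measurable_digit (i : 'I_m) : measurable (dig @^-1` [set i]).
Proof.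
have [b0 b1 _] := hb.
have inI (x : R) : 0 <= x < 1 -> (dig x = i <-> b i <= x < b i.+1).
  move=> x01; split=> [<-|]; first exact: digitP.
  exact: digit_uniq.
have outI (x : R) : ~~ (0 <= x < 1) -> dig x = i0.
  move=> x01; rewrite /digit; case: xgetP => // j _ /= /andP[jx xj].
  have [bj0 bj1] := partition_itv01 hb j.
  by move: x01; rewrite (le_trans bj0 jx) (lt_le_trans xj bj1).
have -> : dig @^-1` [set i] =
    `[b i, b i.+1[%classic `|` (if i == i0 then ~` `[0, 1[%classic else set0).
  apply/seteqP; split => x /=.
    have [x01|x01] := boolP (0 <= x < 1).
      by move=> /(inI _ x01).1 ?; left; rewrite /= in_itv.
    move=> di; right; rewrite -di outI// eqxx /= in_itv/=; exact/negP.
  move=> [|]; rewrite /= ?in_itv/=; first exact: digit_uniq.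
  case: eqP => // -> /= /negP; rewrite in_itv/=; exact: outI.
apply: measurableU; first exact: measurable_itv.
by case: ifP => // _; apply: measurableC; exact: measurable_itv.
Qed.

Lemma measurable_shift : measurable_fun setT shf.
Proof.
apply: (@measurable_fun_fibers _ _ _ _ _ dig measurable_digit
  (fun i x => (x - b i) / len b i)) => i.
by apply: measurable_funM => //; exact: measurable_funB.
Qed.

Lemma measurable_iter_shift n : measurable_fun setT (iter n shf).
Proof.
elim: n => [|n ih]; first exact: measurable_id.
exact: (measurableT_comp measurable_shift).
Qed.

Lemma size_wordb n x : size (wrd n x) == n.
Proof. by rewrite size_word. Qed.
Definition word_tuple n x : n.-tuple 'I_m := Tuple (size_wordb n x).

Lemma measurable_word_tuple n (w : n.-tuple 'I_m) :
  measurable (word_tuple n @^-1` [set w]).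
Proof.
have -> : word_tuple n @^-1` [set w] = wrd n @^-1` [set val w].
  by apply/seteqP; split => x /= => [<-//|h]; exact/val_inj.
case: w => w /= /eqP; elim: n w => [|n ih] [|i w]// => [_|[wn]].
  by rewrite [X in measurable X](_ : _ = setT)//; apply/seteqP; split.
have -> : wrd n.+1 @^-1` [set (i :: w)] =
    dig @^-1` [set i] `&` shf @^-1` (wrd n @^-1` [set w]).
  by apply/seteqP; split => x /= => [[<- <-]//|[-> ->]].
apply: measurableI; first exact: measurable_digit.
by rewrite -[X in measurable X]setTI; apply: measurable_shift => //; exact: ih.
Qed.

Lemma cylinder_itv (a c : R) w : 0 <= a -> c <= 1 ->
  `[0, 1[%classic `&` (wrd (size w) @^-1` [set w] `&`
    iter (size w) shf @^-1` `[a, c[%classic) =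
  `[zoom b w a, zoom b w c[%classic.
Proof.
move=> a0 c1; have w0 := wlen_gt0 hb w.
apply/seteqP; split => x /=; rewrite !in_itv/=.
  move=> [x01 [xw /andP[ax xc]]].
  rewrite -(zoom_word i0 hb (size w) x) xw !(zoomE b w (iter _ _ _)).
  rewrite (zoomE b w a) (zoomE b w c).
  by rewrite lerD2r ltrD2r ler_pM2l// ltr_pM2l// ax.
rewrite (zoomE b w a) (zoomE b w c) => /andP[ax xc].
pose z := (x - zoom b w 0) / wlen b w.
have xE : x = zoom b w z by rewrite zoomE /z mulrC divfK ?subrK ?gt_eqF.
have az : a <= z by rewrite /z ler_pdivlMr// mulrC lerBrDr.
have zc : z < c by rewrite /z ltr_pdivrMr// mulrC ltrBlDr.
have z01 : 0 <= z < 1 by rewrite (le_trans a0 az) (lt_le_trans zc c1).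
rewrite xE (word_zoom i0 hb)// (iter_shift_zoom i0 hb)// az zc.
by split => //; exact: zoom_itvco.
Qed.

Lemma unit_lebesgue_cylinder n (w : n.-tuple 'I_m) (a c : R) : 0 <= a <= c -> c <= 1 ->
  unit_lebesgue (iter n shf @^-1` `[a, c[%classic `&` word_tuple n @^-1` [set w]) =
  (wlen b w * (c - a))%:E.
Proof.
move=> /andP[a0 ac] c1; rewrite /unit_lebesgue /mrestr.
have -> : iter n shf @^-1` `[a, c[%classic `&` word_tuple n @^-1` [set w] `&` `[0, 1[ =
    `[zoom b w a, zoom b w c[%classic.
  rewrite -cylinder_itv// size_tuple setIC (setIC (iter _ _ @^-1` _)).
  congr (_ `&` (_ `&` _)).
  by apply/seteqP; split => x /= => [<-//|h]; exact/val_inj.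
rewrite lebesgue_measure_itv/= lte_fin.
rewrite (zoomE b w a) (zoomE b w c) ltrD2r ltr_pM2l ?wlen_gt0//.
have [ac'|ac'] := ltP a c.
  by rewrite -EFinB; congr EFin; ring.
have -> : a = c by apply/eqP; rewrite eq_le ac.
by rewrite subrr mulr0.
Qed.

Lemma unit_lebesgue_word n (w : n.-tuple 'I_m) :
  unit_lebesgue (word_tuple n @^-1` [set w]) = (wlen b w)%:E.
Proof.
rewrite -[RHS](_ : (wlen b w * (1 - 0))%:E = _); last by rewrite subr0 mulr1.
rewrite -unit_lebesgue_cylinder ?lexx ?ler01//.
rewrite /unit_lebesgue /mrestr; congr (lebesgue_measure _).
apply/seteqP; split => x /= [xw x01].
  split => //; split => //; rewrite in_itv/=.
  by apply: (iter_shift_ge0_lt1 i0 hb); rewrite in_itv/= in x01.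
by case: xw.
Qed.

(** The shift preserves Lebesgue measure on [0, 1[: the preimage
meets the interval of each address of length n in the same proportion c - a. *)
Lemma unit_lebesgue_iter_shift n (a c : R) : 0 <= a <= c -> c <= 1 ->
  unit_lebesgue (iter n shf @^-1` `[a, c[%classic) = (c - a)%:E.
Proof.
move=> ac c1.
have mE : measurable (iter n shf @^-1` `[a, c[%classic).
  by rewrite -[X in measurable X]setTI; apply: measurable_iter_shift.
rewrite [LHS](@measure_fibers _ (measurableTypeR R) R _ _
  (@measurable_word_tuple n) (@unit_lebesgue R) _ mE).
transitivity (\sum_(w : n.-tuple 'I_m) (wlen b w * (c - a))%:E)%E.
  by apply: eq_bigr => w _; exact: unit_lebesgue_cylinder.
rewrite sumEFin -mulr_suml; congr EFin.
rewrite (eq_bigr (fun w : n.-tuple 'I_m => \prod_(k < n) len b (tnth w k))); last first.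
  by move=> w _; rewrite /wlen big_tuple.
rewrite (sum_tuple_prod n (fun _ (i : 'I_m) => len b i)) big1 ?mul1r// => k _.
exact: sum_len.
Qed.

End coding_measure.

Lemma unit_lebesgue_ae (R : realType) (p : measurableTypeR R -> Prop) :
  {ae unit_lebesgue, forall x, p x} ->
  {ae lebesgue_measure, forall x : R, x \in `[0, 1]%R -> 0 <= x < 1 /\ p x}.
Proof.
move=> [N [mN N0 pN]].
exists ((N `&` `[0, 1[%classic) `|` [set 1]); split.
- by apply: measurableU => //; exact: measurableI.
- apply/eqP; rewrite -measure_le0 (le_trans (measureU2 _ _ _))//.
    exact: measurableI.
  rewrite le_eqVlt; apply/orP; left; apply/eqP.
  transitivity (0 + 0 : \bar R)%E; last by rewrite adde0.
  by congr (_ + _)%E; [exact: N0|exact: lebesgue_measure_set1].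
- move=> x /= /not_implyP[]; rewrite in_itv/= => /andP[x0 x1] npx.
  have [->|xn1] := eqVneq x 1; [by right|left].
  have x01 : 0 <= x < 1 by rewrite x0 lt_neqAle xn1.
  by split; [apply: pN => px; apply: npx|rewrite /= in_itv].
Qed.

(** * The slopes at a random point *)

Section sample_measure.
Context {R : realType} {d : measure_display} {Theta : measurableType d}
  (P : probability Theta R).

(** A random realization together with an independent uniform point. *)
Definition sample_measure : set (Theta * measurableTypeR R) -> \bar R :=
  (P \x @unit_lebesgue R)%E.

HB.instance Definition _ := Measure.on sample_measure.

Lemma sample_measure_setT : sample_measure setT = 1%E.
Proof.
rewrite /sample_measure -setXTT product_measure1E//.
transitivity (1 * 1 : \bar R)%E; last by rewrite mule1.
by congr (_ * _)%E; [exact: probability_setT|exact: unit_lebesgue_setT].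
Qed.

HB.instance Definition _ :=
  Measure_isProbability.Build _ _ _ sample_measure sample_measure_setT.

Lemma sample_ae (p : Theta -> measurableTypeR R -> Prop) :
  {ae sample_measure, forall z, p z.1 z.2} ->
  {ae P, forall t, {ae unit_lebesgue, forall x : measurableTypeR R, p t x}}.
Proof.
move=> [N [mN N0 pN]].
have mx : measurable_fun setT (fun t => unit_lebesgue (xsection N t)).
  exact: measurable_fun_xsection.
have : (\int[P]_t `|unit_lebesgue (xsection N t)| = 0)%E.
  rewrite -N0 /sample_measure /product_measure1; apply: eq_integral => t _ /=.
  by rewrite gee0_abs.
move/ae_eq_integral_abs => /(_ measurableT mx); apply: filterS => t /(_ I) Nt.
exists (xsection N t); split.
- exact: measurable_xsection.
- exact: Nt.
- by move=> x /= npx; rewrite /xsection/= inE; apply: pN.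
Qed.

End sample_measure.

Section slopes.
Context {R : realType} {d : measure_display} {Theta : measurableType d}
  (P : probability Theta R) {m : nat} (b : nat -> R) (i0 : 'I_m).
Hypothesis hb : is_partition m b.
Variable Y : seq 'I_m -> {RV P >-> m.-1.-tuple R}.
Local Notation dig := (digit b i0).
Local Notation shf := (shift b i0).
Local Notation wrd := (word b i0).

Definition increment (v : m.-1.-tuple R) (i : nat) : R :=
  knot v i.+1 - knot v i.

(** The factor by which the chord slope of the graph changes from level k to
level k + 1 of the address of the point. *)
Definition slope (k : nat) (z : Theta * measurableTypeR R) : R :=
  increment (Y (wrd k z.2) z.1) (dig (iter k shf z.2)) /
  len b (dig (iter k shf z.2)).

Lemma measurable_knot n : measurable_fun setT (fun v : m.-1.-tuple R => knot v n).
Proof.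
case: n => [|n]; first exact: measurable_cst.
have [nm|nm] := ltnP n m.-1.
  have -> : (fun v : m.-1.-tuple R => knot v n.+1) = (fun v => tnth v (Ordinal nm)).
    apply/funext => v; rewrite /knot/= nth_rcons size_tuple nm.
    by rewrite (tnth_nth 0).
  exact: measurable_tnth.
have -> : (fun v : m.-1.-tuple R => knot v n.+1) = cst (if n == m.-1 then 1 else 0).
  by apply/funext => v; rewrite /knot/= nth_rcons size_tuple ltnNge nm.
exact: measurable_cst.
Qed.

Lemma measurable_increment i : measurable_fun setT (fun v => increment v i).
Proof. by apply: measurable_funB; exact: measurable_knot. Qed.

Let ratio (i : 'I_m) (v : m.-1.-tuple R) : R := increment v i / len b i.

Let mratio i : measurable_fun setT (ratio i).
Proof. by apply: measurable_funM => //; exact: measurable_increment. Qed.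

Lemma measurable_slope k : measurable_fun setT (slope k).
Proof.
pose c (z : Theta * measurableTypeR R) := word_tuple b i0 k.+1 z.2.
have mc w : measurable (c @^-1` [set w]).
  have -> : c @^-1` [set w] = snd @^-1` (word_tuple b i0 k.+1 @^-1` [set w]) by [].
  rewrite -[X in measurable X]setTI; apply: measurable_snd => //.
  exact: measurable_word_tuple.
have -> : slope k = fun z =>
    ratio (nth i0 (c z) k) (Y (take k (c z)) z.1).
  apply/funext => z; rewrite /slope /ratio /=.
  rewrite -[dig z.2 :: _]/(wrd k.+1 z.2) nth_word// take_word//.
apply: (@measurable_fun_fibers _ _ _ _ _ c mc
  (fun (w : k.+1.-tuple 'I_m) z => ratio (nth i0 w k) (Y (take k w) z.1))) => w.
apply: (measurableT_comp (mratio _)).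
by apply: measurableT_comp.
Qed.

Let digit_prob (B : set R) (i : 'I_m) : R := fine (P (Y [::] @^-1` (ratio i @^-1` B))).

Let mpre (v : seq 'I_m) i B : measurable B -> measurable (Y v @^-1` (ratio i @^-1` B)).
Proof.
move=> mB; rewrite -[X in measurable X]setTI.
by apply: (measurableT_comp (mratio i)).
Qed.

Hypothesis Yindep : mutually_independent Y.
Hypothesis Yident : identically_distributed Y.

(** On the event that the address begins with a given word w, the slopes are
functions of the vectors attached to the n proper prefixes of w.  These prefixes
are distinct, so the vectors are independent, and the sum over w of the products
of lengths and probabilities factors. *)
Lemma slope_iid_prob n (B : nat -> set R) : (forall k, measurable (B k)) ->
  sample_measure P (\bigcap_(k < n) (slope k @^-1` B k)) =
  (\prod_(k < n) \sum_(i < m) len b i * digit_prob (B k) i)%:E.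
Proof.
move=> mB.
pose c (z : Theta * measurableTypeR R) := word_tuple b i0 n z.2.
have mc w : measurable (c @^-1` [set w]).
  have -> : c @^-1` [set w] = snd @^-1` (word_tuple b i0 n @^-1` [set w]) by [].
  rewrite -[X in measurable X]setTI; apply: measurable_snd => //.
  exact: measurable_word_tuple.
have mE : measurable (\bigcap_(k < n) (slope k @^-1` B k)).
  apply: fin_bigcap_measurable => // k _.
  by rewrite -[X in measurable X]setTI; exact: measurable_slope.
rewrite [LHS](measure_fibers mc (sample_measure P) mE).
rewrite -(sum_tuple_prod n (fun k (i : 'I_m) => len b i * digit_prob (B k) i)) -sumEFin.
apply: eq_bigr => w _.
pose A := \bigcap_(v in [set` [seq take k w | k <- iota 0 n]])
  (Y v @^-1` (ratio (nth i0 w (size v)) @^-1` B (size v))).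
have sz k : (k < n)%N -> size (take k w) = k.
  by move=> kn; rewrite size_take size_tuple kn.
have -> : \bigcap_(k < n) (slope k @^-1` B k) `&` c @^-1` [set w] =
    A `*` (word_tuple b i0 n @^-1` [set w]).
  apply/seteqP; split => [[t x] /= [sB cw]|[t x] /= [At xw]]; split => //.
    move=> v /= /mapP[k]; rewrite mem_iota add0n /= => kn ->; rewrite sz//.
    have := sB k kn; rewrite /slope /= -(nth_word b i0 x kn).
    by rewrite -(take_word b i0 x (ltnW kn)) (congr1 val cw : wrd n x = w).
  move=> k /= kn; rewrite /slope /= -(nth_word b i0 x kn).
  rewrite -(take_word b i0 x (ltnW kn)) (congr1 val xw : wrd n x = w).
  have := At (take k w); rewrite sz//; apply; apply: map_f.
  by rewrite mem_iota.
transitivity (P A * (wlen b w)%:E)%E.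
  rewrite -(unit_lebesgue_word i0 hb); apply: product_measure1E.
    by apply: fin_bigcap_measurable => // v _; exact: mpre.
  exact: measurable_word_tuple.
rewrite /A Yindep; last 2 first.
- rewrite map_inj_in_uniq ?iota_uniq// => j k; rewrite !mem_iota !add0n /= => jn kn.
  by move/(congr1 size); rewrite !sz.
- move=> v; rewrite -[X in measurable X]setTI; exact: mratio.
rewrite big_map -[in iota _ _](subn0 n) big_mkord.
rewrite big_split/= EFinM muleC; congr (_ * _)%E.
  by rewrite /wlen big_tuple.
rewrite -prodEFin; apply: eq_bigr => k _.
rewrite sz// (tnth_nth i0) /digit_prob fineK; last first.
  by rewrite fin_num_measure//; exact: mpre.
have := @Yident (take k w) [::] (ratio (nth i0 w k) @^-1` B k).
by apply; rewrite -[X in measurable X]setTI; exact: mratio.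
Qed.

Lemma slope0_prob B : measurable B ->
  sample_measure P (slope 0 @^-1` B) = (\sum_(i < m) len b i * digit_prob B i)%:E.
Proof.
move=> mB; have := @slope_iid_prob 1 (fun=> B) (fun=> mB).
rewrite big_ord1 => <-; congr (sample_measure P _).
by rewrite bigcap_mkord big_ord1.
Qed.

Lemma slope_iid : iid (sample_measure P) slope.
Proof.
move=> n B mB; apply: (eq_trans (slope_iid_prob n mB)).
rewrite -prodEFin; apply: eq_bigr => k _.
exact/esym/slope0_prob.
Qed.

End slopes.

Section drift.
Context {R : realType} {d : measure_display} {Theta : measurableType d}
  (P : probability Theta R) {m : nat} (b : nat -> R) (i0 : 'I_m).
Hypothesis hb : is_partition m b.
Variable Y : seq 'I_m -> {RV P >-> m.-1.-tuple R}.
Hypothesis Y01 : forall w t (j : 'I_m.-1), 0 <= tnth (Y w t) j <= 1.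
Hypothesis Yindep : mutually_independent Y.
Hypothesis Yident : identically_distributed Y.
Local Notation dig := (digit b i0).
Local Notation slp := (slope b i0 Y).

Lemma knot_itv01 w t k : 0 <= knot (Y w t) k <= 1.
Proof.
rewrite /knot; case: k => [|k] /=; first by rewrite lexx ler01.
rewrite nth_rcons size_tuple; case: ltnP => [km|_].
  by have := Y01 w t (Ordinal km); rewrite (tnth_nth 0).
by case: eqP; rewrite ?lexx ler01.
Qed.

Lemma height_le1 w t k : height (Y w t) k <= 1.
Proof.
have := knot_itv01 w t k.+1; have := knot_itv01 w t k.
by rewrite /height ler_norml => /andP[? ?] /andP[? ?]; lra.
Qed.

(** The second bound makes M + log (len b i) nonnegative for M = log C, which
the computation of the drift needs. *)
Lemma exists_slope_bound : exists C,
  [/\ 1 <= C, forall i : 'I_m, - ln (len b i) <= ln C &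
      forall k z, `|slp k z| <= C].
Proof.
have [c /andP[c0 c1] cl] := exists_len_lbound hb.
exists c^-1; split; first by rewrite -[leLHS]invr1 lef_pV2// posrE.
  move=> i; have l0 := len_gt0 hb i.
  by rewrite lnV ?posrE// lerN2 ler_ln// ?posrE.
move=> k z; rewrite /slope normrM normfV.
set i := dig _; have l0 := len_gt0 hb i.
rewrite -[leRHS]mul1r ler_pM ?invr_ge0 ?normr_ge0//.
  exact: height_le1.
by rewrite gtr0_norm// lef_pV2 ?posrE.
Qed.

Lemma unit_lebesgue_digit (i : 'I_m) :
  unit_lebesgue (dig @^-1` [set i]) = (len b i)%:E.
Proof.
have -> : dig @^-1` [set i] = word_tuple b i0 1 @^-1` [set [tuple i]].
  by apply/seteqP; split => x /= [ix]; [apply: val_inj; rewrite /= ix|].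
by rewrite unit_lebesgue_word// /wlen big_seq1.
Qed.

Local Open Scope ereal_scope.

(** A form of distributivity that remains valid when some x i is -oo, because
no term or sum is ever +oo on the side that is subtracted. *)
Lemma sum_weighted_defect (I : Type) (r : seq I) (M : R) (c l : I -> R)
    (x : I -> \bar R) : (forall i, (0 < l i)%R) -> (forall i, x i <= 0) ->
  \sum_(i <- r) ((M + c i)%:E - x i) * (l i)%:E =
  (M * \sum_(i <- r) l i)%:E - \sum_(i <- r) (l i)%:E * (x i - (c i)%:E).
Proof.
move=> l0 x0.
suff [] : \sum_(i <- r) ((M + c i)%:E - x i) * (l i)%:E =
  (M * \sum_(i <- r) l i)%:E - \sum_(i <- r) (l i)%:E * (x i - (c i)%:E) /\
  \sum_(i <- r) (l i)%:E * (x i - (c i)%:E) != +oo by [].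
elim: r => [|i r [ih1 ih2]].
  by rewrite !big_nil mulr0 sube0.
rewrite !big_cons ih1.
move: ih2 (x0 i); case: (\sum_(j <- r) (l j)%:E * _) => [S| |]// _;
  case: (x i) => [y| |]// _.
- by split => //; rewrite -!(EFinB, EFinM, EFinD); congr EFin; ring.
- by rewrite /= gt0_mulye ?gt0_muleNy ?lte_fin.
- by rewrite /= gt0_mulye ?gt0_muleNy ?lte_fin.
Qed.

(** Since log |slope| is bounded above by M = log C, the function M - log |slope|
is nonnegative and Tonelli's theorem applies to it even if phi is -oo: the inner
integral depends on x only through its first digit i, which has probability
len b i.  Subtracting from M on both sides loses no information. *)
Lemma integral_lne_slope :
  \int[sample_measure P]_z lne `|slp 0 z|%:E = phi b Y.
Proof.
have [C [C1 Clen Cslope]] := exists_slope_bound.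
set M := ln C in Clen.
have M0 : (0 <= M)%R by exact: ln_ge0.
have C0 : (0 < C)%R by exact: lt_le_trans C1.
pose f z := lne `|slp 0 z|%:E.
have mf : measurable_fun setT f.
  apply: measurable_lne; apply: measurableT_comp => //.
  exact: measurable_slope.
have fM z : f z <= M%:E.
  rewrite -lne_EFin// lee_lne ?in_itv/= ?leey ?andbT ?lee_fin//.
  exact: ltW.
have mh (i : 'I_m) : measurable_fun setT (fun t => lne (height (Y [::] t) i)%:E).
  apply: measurable_lne; apply: measurableT_comp => //.
  exact: (measurableT_comp (measurable_increment i)).
have h0 (i : 'I_m) t : lne (height (Y [::] t) i)%:E <= 0.
  by rewrite lne_le0 lee_fin height_le1.
pose I (i : 'I_m) := \int[P]_t lne (height (Y [::] t) i)%:E.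
have I0 i : I i <= 0.
  rewrite /I (eq_integral (fun t => - - lne (height (Y [::] t) i)%:E)); last first.
    by move=> t _; rewrite oppeK.
  rewrite integral_ge0N => [|t _]; last by rewrite oppe_ge0.
  by rewrite oppe_le0; apply: integral_ge0 => t _; rewrite oppe_ge0.
have key : M%:E - \int[sample_measure P]_z f z = M%:E - phi b Y.
  rewrite -integral_cstB//.
  have mg : measurable_fun setT (fun z => M%:E - f z).
    by apply: emeasurable_funB => //.
  have g0 z : 0 <= M%:E - f z by rewrite sube_ge0 ?orbT.
  transitivity (\int[unit_lebesgue]_x \int[P]_t (M%:E - f (t, x))).
    exact: (fubini_tonelli2 _ mg g0).
  transitivity (\int[@unit_lebesgue R]_x ((M + ln (len b (dig x)))%:E - I (dig x))).
    apply: eq_integral => x _; have l0 := len_gt0 hb (dig x).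
    rewrite -integral_cstB//; last 2 first.
    - by have := Clen (dig x); lra.
    - move=> t; rewrite (le_trans (h0 _ _))// lee_fin.
      by have := Clen (dig x); lra.
    apply: eq_integral => t _; rewrite /f.
    have -> : `|slp 0 (t, x)|%R =
        (height (Y [::] t) (dig x) * (len b (dig x))^-1)%R.
      by rewrite /slope normrM normfV (gtr0_norm l0).
    rewrite lne_mulr_ge0 ?normr_ge0 ?invr_ge0 ?(ltW l0)//.
    rewrite [lne (_^-1)%:E]lne_EFin ?invr_gt0// lnV ?posrE//.
    have := h0 (dig x) t; case: (lne (height _ _)%:E) => [y| |]// _.
    by rewrite -!(EFinB, EFinD); congr EFin; ring.
  rewrite (@ge0_integral_fibers _ (measurableTypeR R) R _ _
    (measurable_digit i0 hb) (@unit_lebesgue R)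
    (fun i => (M + ln (len b i))%:E - I i)); last first.
    move=> i; rewrite sube_ge0 ?orbT// (le_trans (I0 i))// lee_fin.
    by have := Clen i; lra.
  transitivity (\sum_(i < m)
      ((M + ln (len b i))%:E - I i) * (len b i)%:E).
    by apply: eq_bigr => i _; congr (_ * _); exact: unit_lebesgue_digit.
  rewrite sum_weighted_defect//; last by move=> i; exact: len_gt0.
  by rewrite sum_len// mulr1.
move: key; rewrite -/f; case: (\int[_]_z f z) => [x| |]; case: (phi b Y) => [y| |]//.
by move=> [] /addrI/oppr_inj ->.
Qed.

(** The digit 1, which exists because m >= 2, has positive probability, and
given this digit the slope differs from 1 with positive probability. *)
Lemma slope0_eq1_lt1 : (2 <= m)%N ->
  (forall i : nat, (1 <= i <= m.-1)%N ->
     (P [set t | (knot (Y [::] t) i.+1 - knot (Y [::] t) i)%R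
                  = (b i.+1 - b i)%R] < 1)%E) ->
  sample_measure P (slp 0 @^-1` [set 1%R]) < 1.
Proof.
move=> m2 nd.
rewrite (slope0_prob i0 hb Yindep Yident)// -[X in _ < X%:E](sum_len hb) lte_fin.
pose i1 := Ordinal m2.
rewrite [ltLHS](bigD1 i1)//= [ltRHS](bigD1 i1)//=.
have fin_ A : measurable A -> P A \is a fin_num by move=> mA; rewrite fin_num_measure.
have mpre (i : 'I_m) : measurable (Y [::] @^-1`
    ((fun v => increment v i / len b i)%R @^-1` [set 1%R])).
  rewrite -[X in measurable X]setTI.
  apply: (@measurableT_comp _ _ _ _ _ _ (fun v => increment v i / len b i)%R) => //.
  by apply: measurable_funM => //; exact: measurable_increment.
apply: ltr_leD.
  rewrite -[ltRHS]mulr1 ltr_pM2l ?(len_gt0 hb i1)//.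
  have := nd 1%N; rewrite /= -ltnS prednK ?(ltnW m2)// => /(_ m2).
  have l1 := len_gt0 hb i1.
  have <- : Y [::] @^-1` ((fun v => increment v i1 / len b i1)%R @^-1` [set 1%R]) =
      [set t | (knot (Y [::] t) 2 - knot (Y [::] t) 1)%R = (b 2 - b 1)%R].
    apply/seteqP; split => t /=; first by move/divr1_eq.
    by rewrite /increment /len => ->; rewrite divff// gt_eqF.
  by rewrite -(fineK (fin_ _ (mpre i1))) lte_fin.
apply: ler_sum => i _; rewrite ler_piMr ?(ltW (len_gt0 hb i))//.
have := probability_le1 P (mpre i).
by rewrite -(fineK (fin_ _ (mpre i))) lee_fin.
Qed.

End drift.

(** * Geometry of the random curve *)

Section curve.
Context {R : realType} {m : nat} (b : nat -> R).
Hypothesis hb : is_partition m b.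
Variable Y : seq 'I_m -> m.-1.-tuple R.
Hypothesis Yk : forall w k, 0 <= knot (Y w) k <= 1.

(** The action on second coordinates of the maps attached to the words between
u and u ++ w. *)
Fixpoint ymap (u w : seq 'I_m) (y : R) : R :=
  if w is i :: w' then increment (Y u) i * ymap (rcons u i) w' y + knot (Y u) i
  else y.

(** The linear coefficient of the affine map ymap u w, that is, the signed
height of the rectangle of address w when u is empty. *)
Fixpoint rise (u w : seq 'I_m) : R :=
  if w is i :: w' then increment (Y u) i * rise (rcons u i) w' else 1.

Lemma compose_mapsE u w p :
  compose_maps b Y u w p = (zoom b w p.1, ymap u w p.2).
Proof. by elim: w u p => [|i w ih] u [x y] //=; rewrite ih. Qed.

Lemma ymapE u w y : ymap u w y = rise u w * y + ymap u w 0.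
Proof.
elim: w u => [|i w ih] u /=; first by rewrite mul1r addr0.
by rewrite ih mulrDr addrA mulrA.
Qed.

Lemma zoom_cat (w1 w2 : seq 'I_m) z : zoom b (w1 ++ w2) z = zoom b w1 (zoom b w2 z).
Proof. by elim: w1 => //= i w ->. Qed.

Lemma ymap_cat u w1 w2 y : ymap u (w1 ++ w2) y = ymap u w1 (ymap (u ++ w1) w2 y).
Proof.
elim: w1 u => [|i w1 ih] u /=; first by rewrite cats0.
by rewrite ih cat_rcons.
Qed.

Lemma rise_rcons u w i : rise u (rcons w i) = rise u w * increment (Y (u ++ w)) i.
Proof.
elim: w u => [|j w ih] u /=; first by rewrite cats0 mulr1 mul1r.
by rewrite ih cat_rcons mulrA.
Qed.

Lemma ymap_itvcc u w y : 0 <= y <= 1 -> 0 <= ymap u w y <= 1.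
Proof.
move=> y01; elim: w u => //= i w ih u.
have := ih (rcons u i); have := Yk u i.+1; have := Yk u i.
rewrite /increment; move: (knot _ _) (knot _ _) (ymap _ _ _) => k1 k2 v.
by move=> /andP[? ?] /andP[? ?] /andP[? ?]; apply/andP; split; nra.
Qed.

Lemma rectangleP (w : seq 'I_m) x y : rectangle b Y w (x, y) <->
  exists z v, [/\ 0 <= z <= 1, 0 <= v <= 1, x = zoom b w z & y = ymap [::] w v].
Proof.
rewrite /rectangle; split => [[[z v] [/= hz hv]]|[z [v [hz hv -> ->]]]].
  by rewrite compose_mapsE/= => -[<- <-]; exists z, v; rewrite !in_itv/= in hz hv.
by exists (z, v); [split; rewrite /= in_itv|rewrite compose_mapsE].
Qed.

(** The point (z, y) is fixed by all the maps of index i, so appending i to a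
word any number of times does not move its image; it therefore stays in the
rectangles of all generations. *)
Lemma limit_set_corner (i : 'I_m) (z y : R) (w : seq 'I_m) :
  0 <= z <= 1 -> 0 <= y <= 1 ->
  len b i * z + b i = z ->
  (forall u, increment (Y u) i * y + knot (Y u) i = y) ->
  limit_set b Y (zoom b w z, ymap [::] w y).
Proof.
move=> z01 y01 zi yi n /= _.
have zn k : zoom b (nseq k i) z = z by elim: k => //= k ->.
have yn k u : ymap u (nseq k i) y = y by elim: k u => //= k ih u; rewrite ih.
have [nw|wn] := leqP n (size w).
  exists (take n w); first by rewrite /= size_take_min; exact/minn_idPl.
  apply/rectangleP; exists (zoom b (drop n w) z), (ymap (take n w) (drop n w) y).
  split; [exact: zoom_itvcc|exact: ymap_itvcc| |].
    by rewrite -zoom_cat cat_take_drop.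
  by rewrite -{1}(cat_take_drop n w) ymap_cat.
exists (w ++ nseq (n - size w) i).
  by rewrite /= size_cat size_nseq subnKC// ltnW.
apply/rectangleP; exists z, y; split => //; first by rewrite zoom_cat zn.
by rewrite ymap_cat yn.
Qed.

Variable f : R -> R.
Hypothesis fG : limit_set b Y = [set p | p.1 \in `[0, 1]%R /\ p.2 = f p.1].

Lemma curve_left_endpoint (w : seq 'I_m) : (0 < m)%N -> f (zoom b w 0) = ymap [::] w 0.
Proof.
move=> m0; have : limit_set b Y (zoom b w 0, ymap [::] w 0).
  apply: (@limit_set_corner (Ordinal m0)); rewrite ?lexx ?ler01//.
    by have [-> _ _] := hb; rewrite mulr0 addr0.
  by move=> u; rewrite mulr0 add0r.
by rewrite fG => -[].
Qed.

Lemma curve_right_endpoint (w : seq 'I_m) : (1 < m)%N -> f (zoom b w 1) = ymap [::] w 1.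
Proof.
move=> m1; have : limit_set b Y (zoom b w 1, ymap [::] w 1).
  have mm : (m.-1 < m)%N by rewrite prednK// ltnW.
  apply: (@limit_set_corner (Ordinal mm)); rewrite ?lexx ?ler01//.
    have [_ b1 _] := hb.
    by rewrite /= /len prednK ?(ltnW m1)// b1 mulr1 subrK.
  move=> u; rewrite /increment /= mulr1 subrK.
  by rewrite /knot /= nth_rcons size_tuple ltnn eqxx.
by rewrite fG => -[].
Qed.

Lemma curve_chord (w : seq 'I_m) : (1 < m)%N ->
  f (zoom b w 1) - f (zoom b w 0) = rise [::] w.
Proof.
move=> m1; rewrite curve_right_endpoint// curve_left_endpoint ?(ltnW m1)//.
by rewrite ymapE mulr1 addrK.
Qed.

(** A point of the graph over the interior of an interval lies in the rectangle
of that interval, because no other closed interval of the same generation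
contains its abscissa. *)
Lemma curve_interior (w : seq 'I_m) z : (0 < size w)%N -> 0 < z < 1 ->
  exists2 y, 0 <= y <= 1 & f (zoom b w z) = ymap [::] w y.
Proof.
move=> w0 z01.
have /andP[zw0 zw1] := zoom_itvoo hb w z01.
have : limit_set b Y (zoom b w z, f (zoom b w z)).
  by rewrite fG /=; split => //; rewrite in_itv/= !ltW.
move=> /(_ (size w) w0)[w' /= ww'] /rectangleP[z' [y [z'01 y01 zE fE]]].
by exists y => //; rewrite fE (zoom_inj hb (esym ww') z01 z'01 zE).
Qed.

Lemma curve_oscillation (w : seq 'I_m) z z' :
  (0 < size w)%N -> 0 < z < 1 -> 0 < z' < 1 ->
  `|f (zoom b w z) - f (zoom b w z')| <= `|rise [::] w|.
Proof.
move=> w0 z01 z'01.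
have [y /andP[y0 y1] ->] := curve_interior w0 z01.
have [y' /andP[y'0 y'1] ->] := curve_interior w0 z'01.
rewrite ymapE (ymapE _ _ y') opprD addrACA subrr addr0 -mulrBr normrM.
by rewrite ler_piMr// ler_norml; lra.
Qed.

Variable i0 : 'I_m.
Hypothesis m1 : (1 < m)%N.
Local Notation dig := (digit b i0).
Local Notation shf := (shift b i0).
Local Notation wrd := (word b i0).
Variable s : nat -> R.
Variable x : R.
Hypothesis x01 : 0 <= x < 1.
Hypothesis sE : forall k,
  s k = increment (Y (wrd k x)) (dig (iter k shf x)) / len b (dig (iter k shf x)).

Lemma rise_word n :
  rise [::] (wrd n x) = (\prod_(k < n) s k) * wlen b (wrd n x).
Proof.
elim: n => [|n ih]; first by rewrite big_ord0 /wlen big_nil mulr1.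
rewrite wordS rise_rcons ih /= big_ord_recr/= sE.
rewrite /wlen -cats1 big_cat/= big_seq1.
have l0 := len_gt0 hb (dig (iter n shf x)); field.
exact: lt0r_neq0.
Qed.

(** The chord over an interval that contains x has a slope close to the
derivative at x when the interval is short: compare both endpoints with x, which
may itself be an endpoint, and add the two errors. *)
Lemma derivable_prod_cvg : derivable f x 1 -> cvgn (fun n => \prod_(k < n) s k).
Proof.
move=> /cvg_ex[/= D fD]; apply/cvg_ex; exists D.
apply/cvgrPdist_le => /= e e0.
have near_ : exists2 dlt, 0 < dlt & forall h, `|h| < dlt ->
    `|f (x + h) - f x - D * h| <= e * `|h|.
  move/cvgrPdist_le : fD => /(_ e e0)[dlt /= dlt0 dl]; exists dlt => // h hd.
  have [->|h0] := eqVneq h 0.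
    by rewrite addr0 subrr mulr0 subrr !normr0 mulr0.
  have := dl h; rewrite /ball /= sub0r normrN => /(_ hd h0).
  rewrite -[_ *: 1]/(h * 1) mulr1 [h + x]addrC => le_.
  rewrite -ler_pdivrMr ?normr_gt0//.
  rewrite -normf_div (_ : (_ / h) = - (D - h^-1 *: (f (x + h) - f x))) ?normrN//.
  by rewrite /GRing.scale/=; field.
have [dlt dlt0 lin] := near_.
have := @wlen_word_cvg0 _ _ b i0 hb x m1.
move/cvgrPdist_lt => /(_ _ dlt0); apply: filterS => n.
have w0 := wlen_gt0 hb (wrd n x).
rewrite sub0r normrN (gtr0_norm w0) => wd.
have := zoomE b (wrd n x) (iter n shf x); rewrite zoom_word// => xE.
have := iter_shift_ge0_lt1 i0 hb n x01; set z := iter n shf x in xE * => /andP[z0 z1].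
have := curve_chord (wrd n x) m1.
rewrite rise_word zoomE mulr1; set u := zoom _ _ 0 in xE *.
set w := wlen _ _ in w0 xE wd *.
move=> chord; clearbody z u w.
have hz : 0 <= w * z <= w by rewrite mulr_ge0 ?(ltW w0)//= ger_pMr// ltW.
have lu := lin (u - x); have lv := lin (w + u - x).
have nu : `|u - x| = w * z.
  rewrite (_ : u - x = - (w * z)); last by move: xE; lra.
  by rewrite normrN ger0_norm//; case/andP: hz.
have nv : `|w + u - x| = w - w * z.
  rewrite (_ : w + u - x = w - w * z); last by move: xE; lra.
  by rewrite ger0_norm//; case/andP: hz => _; rewrite subr_ge0.
rewrite nu [x + _]addrC subrK in lu; rewrite nv [x + _]addrC subrK in lv.
have {}lu := lu _; have {}lv := lv _.
have /andP[hz0 hz1] := hz.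
have hu : `|f u - f x - D * (u - x)| <= e * (w * z).
  by apply: lu; exact: le_lt_trans wd.
have hv : `|f (w + u) - f x - D * (w + u - x)| <= e * (w - w * z).
  by apply: lv; apply: le_lt_trans wd; rewrite gerBl.
rewrite -(ler_pM2r w0) -{1}(gtr0_norm w0) -normrM mulrBl -chord.
have -> : D * w - (f (w + u) - f u) =
   (f u - f x - D * (u - x)) - (f (w + u) - f x - D * (w + u - x)) by ring.
apply: le_trans (ler_normB _ _) _.
by apply: le_trans (lerD hu hv) _; rewrite -mulrDr addrC subrK.
Qed.

(** Let k be the last level at which x + h is in the open interval of the
address of x.  The oscillation there bounds |f (x + h) - f x| by r^k times the
length of the interval, while leaving the next interval costs at least q^(k+1)
times its length, so |h| is larger by a factor of order (q / r)^k. *)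
Lemma decay_is_derive0 (r q : R) : 0 < r -> r < q -> q < 1 ->
  (\forall n \near \oo, `|\prod_(k < n) s k| < r ^+ n) ->
  (\forall n \near \oo, q ^+ n <= iter n shf x < 1 - q ^+ n) ->
  is_derive x 1 f 0.
Proof.
move=> r0 rq q1 sr xq.
have q0 : 0 < q by exact: lt_trans rq.
have [c /andP[c0 c1] cl] := exists_len_lbound hb.
suff lin e : 0 < e -> exists2 dlt, 0 < dlt &
    forall h, `|h| < dlt -> `|f (x + h) - f x| <= e * `|h|.
  have cv : h^-1 *: (f (h *: 1 + x) - f x) @[h --> 0^'] --> (0 : R).
    apply/cvgrPdist_le => e e0; have [dlt dlt0 hlin] := lin e e0.
    exists dlt => //= h; rewrite /ball/= sub0r normrN => hd h0.
    rewrite sub0r normrN /GRing.scale/= mulr1 normrM normfV mulrC.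
    rewrite ler_pdivrMr ?normr_gt0// [h + x]addrC; exact: hlin.
  by apply: DeriveDef; [apply/cvg_ex; exists 0|exact: cvg_lim cv].
move=> e0.
have rq1 : r / q < 1 by rewrite ltr_pdivrMr// mul1r.
have rq0 : 0 <= r / q by rewrite divr_ge0// ltW.
have [N [N0 NP]] : exists N, (0 < N)%N /\ forall n, (N <= n)%N ->
    [/\ `|\prod_(k < n) s k| < r ^+ n, q ^+ n <= iter n shf x < 1 - q ^+ n &
        (r / q) ^+ n <= e * (q * c)].
  have : (r / q) ^+ n @[n --> \oo] --> (0:R).
    by apply: cvg_expr; rewrite ger0_norm.
  move/cvgrPdist_le => /(_ (e * (q * c)) _)/wrap[]; first by rewrite !mulr_gt0.
  move=> [N3 _ h3]; move: sr xq => [N1 _ h1] [N2 _ h2].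
  exists (N1 + N2 + N3).+1; split => // n Nn; split.
  - apply: h1 => /=; lia.
  - apply: h2 => /=; lia.
  - have /= := h3 n _; rewrite sub0r normrN ger0_norm ?exprn_ge0//; apply.
    lia.
exists (q ^+ N * wlen b (wrd N x)); first by rewrite mulr_gt0 ?exprn_gt0 ?wlen_gt0.
move=> h hd.
have [->|h0] := eqVneq h 0; first by rewrite addr0 subrr !normr0 mulr0.
(* The relative position of x + h in the interval of level n. *)
pose z n := iter n shf x + h / wlen b (wrd n x).
have w0 n : 0 < wlen b (wrd n x) by exact: wlen_gt0.
have xhE n : x + h = zoom b (wrd n x) (z n).
  rewrite zoomE /z mulrDr [_ * (h / _)]mulrC divfK ?lt0r_neq0//.
  by rewrite addrAC -zoomE zoom_word.
have outP : exists n, (N <= n)%N && ~~ (0 < z n < 1).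
  have := @wlen_word_cvg0 _ _ b i0 hb x m1.
  have h0' : 0 < `|h| by rewrite normr_gt0.
  move/cvgrPdist_lt => /(_ _ h0')[N1 _ hN1]; exists (N + N1)%N; rewrite leq_addr/=.
  have := hN1 (N + N1)%N (leq_addl _ _); rewrite /= sub0r normrN gtr0_norm// => wh.
  have /andP[g0 g1] := iter_shift_ge0_lt1 i0 hb (N + N1) x01.
  apply/negP => /andP; rewrite /z; have := w0 (N + N1)%N.
  move: (wlen _ _) (iter _ _ _) wh g0 g1 => w g wh g0 g1 wp.
  have : 1 < `|h / w| by rewrite normrM normfV (gtr0_norm wp) ltr_pdivlMr// mul1r.
  by rewrite ltr_normr => /orP[] ? [? ?]; lra.
have [n /andP[Nn nout] nmin] := ex_minnP outP.
have inN : 0 < z N < 1.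
  have [_ /andP[g0 g1] _] := NP N (leqnn N).
  have : `|h / wlen b (wrd N x)| < q ^+ N.
    by rewrite normrM normfV (gtr0_norm (w0 N)) ltr_pdivrMr.
  by rewrite /z ltr_norml => /andP[? ?]; lra.
case: n => [|k] in Nn nout nmin *.
  by move: Nn inN nout; rewrite leqn0 => /eqP -> ->.
have Nk : (N <= k)%N.
  by move: Nn nout; rewrite leq_eqVlt => /predU1P[<-|//]; rewrite inN.
have ink : 0 < z k < 1.
  apply: contraT => kout; have := nmin k; rewrite Nk kout => /(_ isT).
  by rewrite ltnn.
have [sk /andP[gk0 gk1] ek] := NP k Nk.
have [_ /andP[gS0 gS1] _] := NP k.+1 (leqW Nk).
have qk0 n : 0 < q ^+ n by rewrite exprn_gt0.
have osc : `|f (x + h) - f x| <= r ^+ k * wlen b (wrd k x).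
  rewrite (xhE k) -[in f x](zoom_word i0 hb k x).
  apply: le_trans (curve_oscillation _ _ _) _ => //.
  - by rewrite size_word (leq_trans N0).
  - by have := qk0 k; lra.
  - by rewrite rise_word normrM (gtr0_norm (w0 k)) ler_pM2r// ltW.
have hge : q ^+ k.+1 * wlen b (wrd k.+1 x) <= `|h|.
  rewrite -ler_pdivlMr// -[X in _ / X](gtr0_norm (w0 k.+1)) -normf_div.
  move: nout; rewrite negb_and -!leNgt /z => /orP[] ?.
    by rewrite ler_normr; apply/orP; right; lra.
  by rewrite ler_normr; apply/orP; left; lra.
have wk : c * wlen b (wrd k x) <= wlen b (wrd k.+1 x).
  by rewrite wordS /wlen -cats1 big_cat/= big_seq1 mulrC ler_pM2l// w0.
apply: (le_trans osc).
have : (r / q) ^+ k * (q ^+ k * wlen b (wrd k x)) <=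
    e * (q * c) * (q ^+ k * wlen b (wrd k x)).
  by rewrite ler_pM2r// mulr_gt0.
rewrite mulrA -exprMn divfK ?lt0r_neq0// => /le_trans; apply.
rewrite -mulrA ler_pM2l//; apply: le_trans hge.
rewrite [leLHS](_ : _ = q ^+ k.+1 * (c * wlen b (wrd k x))); last first.
  by rewrite exprS; ring.
by rewrite ler_pM2l.
Qed.

End curve.

(** * Differentiability at almost every point *)

Section uniform_shift.
Context {R : realType} {m : nat} (b : nat -> R) (i0 : 'I_m).
Hypothesis hb : is_partition m b.
Local Notation shf := (shift b i0).

(** The n-th iterate of the shift is uniform, so it is within q^n of 0 or 1 with
probability at most 2 q^n, and these bounds are summable. *)
Lemma iter_shift_away_from_endpoints (q : R) : 0 < q < 1 ->
  {ae unit_lebesgue, forall x : measurableTypeR R,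
    \forall n \near \oo, q ^+ n <= iter n shf x < 1 - q ^+ n}.
Proof.
move=> /andP[q0 q1].
pose G n := iter n shf @^-1` `[q ^+ n, 1 - q ^+ n[%classic.
have mG n : measurable (G n : set (measurableTypeR R)).
  by rewrite -[X in measurable X]setTI; apply: measurable_iter_shift.
have qn0 n : 0 < q ^+ n by rewrite exprn_gt0.
have small n : (0 <= unit_lebesgue (~` G n) <= (2 * q ^+ n)%:E)%E.
  rewrite measure_ge0/=; have [le_|lt_] := leP (q ^+ n) (1 - q ^+ n).
    rewrite [leLHS](probability_setC (@unit_lebesgue R) (mG n)).
    rewrite [X in (_ - X)%E](_ : _ = (1 - q ^+ n - q ^+ n)%:E); last first.
      apply: (unit_lebesgue_iter_shift i0 hb n); first by rewrite ltW//=.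
      by rewrite gerBl ltW.
    by rewrite -EFinB lee_fin; lra.
  apply: le_trans (probability_le1 (@unit_lebesgue R) (measurableC (mG n))) _.
  by rewrite lee_fin; lra.
have sumG : (\sum_(n <oo) unit_lebesgue (~` G n) < +oo)%E.
  by apply: (geometric_bound_sum_lty _ small); rewrite ltW.
have := borel_cantelli_ae (fun n => measurableC (mG n)) sumG.
apply: filterS => x; apply: filterS => n /contrapT.
by rewrite /G /= in_itv.
Qed.

End uniform_shift.

Theorem theorem2p2 (R : realType) (d : measure_display)
    (Theta : measurableType d) (P : probability Theta R)
    (m : nat) (hm : (2 <= m)%N) (b : nat -> R) (hb : is_partition m b)
    (Y : seq 'I_m -> {RV P >-> m.-1.-tuple R})
    (Y01 : forall w t (j : 'I_m.-1), 0 <= tnth (Y w t) j <= 1)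
    (Yindep : mutually_independent Y)
    (Yident : identically_distributed Y)
    (Yint : forall i : nat, (1 <= i <= m.-1)%N ->
      P [set t | knot (Y [::] t) i = 0 \/ knot (Y [::] t) i = 1] = 0%E)
    (Ynondeg : forall i : nat, (1 <= i <= m.-1)%N ->
      (P [set t | (knot (Y [::] t) i.+1 - knot (Y [::] t) i)%R
                    = (b i.+1 - b i)%R] < 1)%E)
    (F : Theta -> R -> R) (hF : random_self_affine b Y F) :
  ((phi b Y < 0)%E ->
     {ae P, forall t : Theta, {ae @lebesgue_measure R, forall x : R,
       x \in `[0, 1]%R -> is_derive x (1 : R) (F t) 0}}) /\
  ((0 <= phi b Y)%E ->
     {ae P, forall t : Theta, {ae @lebesgue_measure R, forall x : R,
       x \in `[0, 1]%R -> ~ derivable (F t) x (1 : R)}}).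
Proof.
rewrite /random_self_affine in hF.
pose i0 : 'I_m := Ordinal (ltnW hm).
pose s := slope b i0 Y.
have ms k : measurable_fun setT (s k) by exact: measurable_slope.
have si : iid (sample_measure P) s by exact: slope_iid.
have [C [C1 _ sC]] := exists_slope_bound i0 hb Y01.
have drift := integral_lne_slope i0 hb Y01.
have knot01 w t k : 0 <= knot (Y w t) k <= 1 by exact: knot_itv01.
have FL : Filter (almost_everywhere (@lebesgue_measure R)).
  exact: ae_filter_ringOfSetsType.
split=> phi0; rewrite -drift in phi0.
- have mnorm : measurable_fun setT (fun x : R => `|x|) by exact: normr_measurable.
  have nsC k z : 0 <= `|s k z| <= C by rewrite normr_ge0 sC.
  have [r /andP[r0 r1] decay] := iid_prod_exponentially_small C1
    (fun k => measurableT_comp mnorm (ms k)) (iid_comp mnorm si) nsC phi0.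
  have [q [q0 rq q1]] : exists q : R, [/\ 0 < q, r < q & q < 1].
    by exists ((1 + r) / 2); split; lra.
  have shiftq : {ae unit_lebesgue, forall x : measurableTypeR R,
      \forall n \near \oo, q ^+ n <= iter n (shift b i0) x < 1 - q ^+ n}.
    by apply: iter_shift_away_from_endpoints => //; rewrite q0.
  have {}decay : {ae P, forall t, {ae unit_lebesgue, forall x : measurableTypeR R,
      \forall n \near \oo, \prod_(k < n) `|s k (t, x)| < r ^+ n}}.
    by apply: sample_ae; apply: filterS decay => -[].
  apply: filterS2 hF decay => t [_ Ft] aex.
  have h1 := unit_lebesgue_ae aex.
  have h2 := unit_lebesgue_ae shiftq.
  apply: filterS2 h1 h2 => x hr hq x01.
  have [x01' xr] := hr x01; have [_ xq] := hq x01.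
  apply: (decay_is_derive0 hb Ft hm x01' (fun k => erefl (s k (t, x))) r0 rq q1 _ xq).
  by apply: filterS xr => n; rewrite normr_prod.
- have s1 := slope0_eq1_lt1 i0 hb Yindep Yident hm Ynondeg.
  have ncvg := iid_prod_not_cvg C1 ms si sC phi0 s1.
  have {}ncvg : {ae P, forall t, {ae unit_lebesgue, forall x : measurableTypeR R,
      ~ cvgn (fun n => \prod_(k < n) s k (t, x))}}.
    by apply: sample_ae; apply: filterS ncvg => -[].
  apply: filterS2 hF ncvg => t [_ Ft] aex.
  have {}aex := unit_lebesgue_ae aex.
  apply: filterS aex => x h x01 dF.
  have [x01' nx] := h x01; apply: nx.
  exact: (derivable_prod_cvg hb (fun w k => knot01 w t k) Ft hm x01'
    (fun k => erefl (s k (t, x))) dF).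
Qed.
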